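(* Let $E_1,E_2$ be normed spaces and let $T:E_1\times E_2\to Y=L^q(u;I)$ be a bounded bilinear map, where $0<q<\infty$. Suppose that $T^{c,d}=\chi_{(c,d)}T$ is compact for every $a<c<d<b$. Then $$\|T\|_{\mathrm e}=\chi_Y\big(T(D_E)\big)=\tau(T).$$ Equivalently, with $\vartheta=\min\{1,q\}$, $$e_\vartheta(T)=\chi_{\rho_Y}\big(T(D_E)\big)=\tau(T)^\vartheta .$$ Moreover, $$T\text{ is compact}\iff \tau(T)=0\iff \lim_{c\downarrow a}\alpha_T(c)=\lim_{d\uparrow b}\beta_T(d)=0 .$$ If $\alpha_{T,*}:=\lim_{c\downarrow a}\alpha_T(c)$ and $\beta_{T,*}:=\lim_{d\uparrow b}\beta_T(d)$, then $$\max\{\alpha_{T,*},\beta_{T,*}\}\le\tau(T)\le\big(\alpha_{T,*}^q+\beta_{T,*}^q\big)^{1/q}.$$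
   Context: Let $-\infty\le a<b\le\infty$ and $I=(a,b)$; $u$ is a nonnegative measurable function on $I$ with $u\in L^1_{\mathrm{loc}}(I)$. For $0<q<\infty$, $Y=L^q(u;I)$ is the space of (real or complex) measurable functions with $\|h\|_Y=(\int_I|h|^qu\,dx)^{1/q}<\infty$, functions equal $u\,dx$-a.e. being identified. Put $\vartheta=\min\{1,q\}$ and $\rho_Y(h,k)=\|h-k\|_Y^\vartheta$, a complete metric; all topological notions in $Y$ refer to it. For normed spaces $E_1,E_2$ let $D_E=B_{E_1}\times B_{E_2}$ be the product of the closed unit balls. A bilinear map $T:E_1\times E_2\to Y$ is bounded if $\|T\|:=\sup_{(x_1,x_2)\in D_E}\|T(x_1,x_2)\|_Y<\infty$, and compact if $T(D_E)$ has compact closure in $Y$. Define $\|T\|_{\mathrm e}=\inf\|T-K\|$ and $e_\vartheta(T)=\inf\|T-K\|^\vartheta$, the infima being over all compact bilinear maps $K:E_1\times E_2\to Y$. For bounded $A\subset Y$, $\chi_Y(A)$ is the infimum of $\varepsilon>0$ such that $A$ is covered by finitely many balls $\{z\in Y:\|z-y_j\|_Y<\varepsilon\}$ with centres $y_j\in Y$; $\chi_{\rho_Y}(A)$ is defined in the same way with open $\rho_Y$-balls $\{z\in Y:\rho_Y(z,y_j)<\varepsilon\}$, $y_j\in Y$. For $a<c<d<b$: $T^{c,d}(x_1,x_2)=\chi_{(c,d)}T(x_1,x_2)$, $\alpha_T(c)=\|\chi_{(a,c)}T\|$, $\beta_T(d)=\|\chi_{(d,b)}T\|$, $\gamma_T(c,d)=\|\chi_{(a,c)\cup(d,b)}T\|$,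 and $\tau(T)=\inf_{a<c<d<b}\gamma_T(c,d)$. If $a=-\infty$, $c\downarrow a$ means $c\to-\infty$; if $b=\infty$, $d\uparrow b$ means $d\to+\infty$. *)

(* Defs.v *)
From HB Require Import structures.
From mathcomp Require Import all_boot all_order all_algebra.
From mathcomp Require Import all_classical all_reals all_analysis.
From mathcomp Require Import generic_quotient measurable_realfun complex.

Set Implicit Arguments.
Unset Strict Implicit.
Unset Printing Implicit Defensive.

Import Order.TTheory GRing.Theory Num.Theory.
Import numFieldNormedType.Exports.

Local Open Scope quotient_scope.
Local Open Scope classical_set_scope.
Local Open Scope ring_scope.

Inductive scalar_kind := RealScalars | ComplexScalars.

Definition scalar_field (R : realType) (k : scalar_kind) : numFieldType :=
  match k with RealScalars => R | ComplexScalars => R[i] end.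

Section scalars.
Context {R : realType}.

Definition re_part {k : scalar_kind} : scalar_field R k -> R :=
  match k with RealScalars => fun x => x | ComplexScalars => @complex.Re R end.

Definition im_part {k : scalar_kind} : scalar_field R k -> R :=
  match k with RealScalars => fun=> 0 | ComplexScalars => @complex.Im R end.

(* `|z| lives in the scalar field itself; this is the same number, in R. *)
Definition modulus {k : scalar_kind} (z : scalar_field R k) : R := re_part `|z|.

Context {k : scalar_kind}.
Implicit Types y z : scalar_field R k.

Lemma re_partD y z : re_part (y + z) = re_part y + re_part z.
Proof. by case: k y z => //= -[? ?] [? ?]. Qed.

Lemma im_partD y z : im_part (y + z) = im_part y + im_part z.
Proof. by case: k y z => /= [? ?|[? ?] [? ?]//]; rewrite addr0. Qed.

Lemma re_partM y z :
  re_part (y * z) = re_part y * re_part z - im_part y * im_part z.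
Proof. by case: k y z => /= [? ?|[? ?] [? ?]//]; rewrite mul0r subr0. Qed.

Lemma im_partM y z :
  im_part (y * z) = re_part y * im_part z + im_part y * re_part z.
Proof.
by case: k y z => /= [? ?|[? ?] [? ?]//]; rewrite mul0r mulr0 addr0.
Qed.

Lemma re_part0 : re_part (0 : scalar_field R k) = 0.
Proof. by case: k. Qed.

Lemma im_part0 : im_part (0 : scalar_field R k) = 0.
Proof. by case: k. Qed.

Lemma modulusE z : modulus z = Num.sqrt (re_part z ^+ 2 + im_part z ^+ 2).
Proof.
rewrite /modulus; case: k z => /= [x|[x y]//].
by rewrite expr0n addr0 sqrtr_sqr.
Qed.

Lemma modulus_ge0 z : 0 <= modulus z.
Proof. by rewrite modulusE sqrtr_ge0. Qed.

Lemma modulus0 : modulus (0 : scalar_field R k) = 0.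
Proof. by rewrite modulusE re_part0 im_part0 expr0n addr0 sqrtr0. Qed.

Lemma modulus_eq0 z : modulus z = 0 -> z = 0.
Proof.
rewrite /modulus; case: k z => /= [x /eqP|z]; first by rewrite normr_eq0 => /eqP.
by case: z => x y /= h; apply/normr0_eq0/eqP; rewrite eq_complex /= h !eqxx.
Qed.

Lemma modulusD y z : modulus (y + z) <= modulus y + modulus z.
Proof.
have := ler_normD y z; rewrite /modulus -re_partD.
by case: k y z => //= y z; rewrite lecE => /andP[].
Qed.

Lemma modulusM y z : modulus (y * z) = modulus y * modulus z.
Proof.
rewrite /modulus normrM re_partM; case: k y z => /= [*|[? ?] [? ?] /=].
  by rewrite mul0r subr0.
by rewrite mul0r subr0.
Qed.

Lemma modulusN z : modulus (- z) = modulus z.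
Proof. by rewrite /modulus normrN. Qed.

End scalars.

Section powR_subadditive.
Context {R : realType}.
Implicit Types s t p : R.

Lemma powR_subadd s t p : 0 <= s -> 0 <= t -> 0 < p <= 1 ->
  (s + t) `^ p <= s `^ p + t `^ p.
Proof.
move=> s0 t0 /andP[p0 p1].
move: s0; rewrite le_eqVlt => /predU1P[<-|s0].
  by rewrite add0r powR0 ?gt_eqF// add0r.
move: t0; rewrite le_eqVlt => /predU1P[<-|t0].
  by rewrite addr0 powR0 ?gt_eqF// addr0.
have st0 : 0 < s + t by rewrite addr_gt0.
have bnd x : 0 < x -> x <= s + t -> x / (s + t) * (s + t) `^ p <= x `^ p.
  move=> x0 xst.
  have -> : x `^ p = (x / (s + t)) `^ p * (s + t) `^ p.
    rewrite -powRM ?(ltW st0)//; last by rewrite divr_ge0// ltW.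
    by rewrite divfK// gt_eqF.
  rewrite ler_pM2r ?powR_gt0//; apply: ger1_powR => //.
  by rewrite divr_gt0//= ler_pdivrMr// mul1r.
have hs : s / (s + t) * (s + t) `^ p <= s `^ p by apply: bnd => //; rewrite lerDl ltW.
have ht : t / (s + t) * (s + t) `^ p <= t `^ p by apply: bnd => //; rewrite lerDr ltW.
apply: le_trans (lerD hs ht).
by rewrite -mulrDl -mulrDl divff ?gt_eqF// mul1r.
Qed.

Lemma powR_quasiadd s t p : 0 <= s -> 0 <= t -> 0 < p ->
  (s + t) `^ p <= 2 `^ p * (s `^ p + t `^ p).
Proof.
move=> s0 t0 p0; set m := Num.max s t.
have m0 : 0 <= m by rewrite le_max s0.
apply: (@le_trans _ _ ((2 * m) `^ p)).
  apply: ge0_ler_powR; rewrite ?nnegrE ?(ltW p0) ?addr_ge0 ?mulr_ge0//.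
  by rewrite mulr_natl mulr2n lerD// le_max lexx ?orbT.
rewrite powRM// ler_wpM2l ?powR_ge0// /m.
by case: (leP s t) => _; rewrite ?lerDl ?lerDr powR_ge0.
Qed.

End powR_subadditive.

Record weight d (X : measurableType d) (R : realType) (D : set X) := Weight {
  weight_fun :> X -> R ;
  measurable_weight_dom : measurable D ;
  measurable_weight : measurable_fun D weight_fun ;
  weight_ge0 : forall x, D x -> 0 <= weight_fun x }.

HB.lock Definition power_integral d (X : measurableType d) (R : realType)
    (mu : {measure set X -> \bar R}) (D : set X) (u : X -> R) (p : R)
    (k : scalar_kind) (f : X -> scalar_field R k) : \bar R :=
  (\int[mu]_(x in D) (modulus (f x) `^ p * u x)%:E)%E.
Canonical locked_power_integral := Unlockable power_integral.unlock.
Arguments power_integral {d X R} mu D u p {k} f.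

Section Lq.
Context d (X : measurableType d) (R : realType).
Variables (mu : {measure set X -> \bar R}) (D : set X) (u : weight R D).
Variables (q : {posnum R}) (k : scalar_kind).
Local Notation K := (scalar_field R k).
Local Notation p := (q%:num).

Local Notation pmass := (power_integral mu D u p).

Definition mem_Lq (f : X -> K) : Prop :=
  [/\ measurable_fun D (re_part \o f), measurable_fun D (im_part \o f) &
      (pmass f < +oo)%E].

Record Lqfun := MkLqfun { Lqfun_fun :> X -> K ; Lqfun_mem : mem_Lq Lqfun_fun }.

(* The set where f and g differ is null for the measure u dmu on D. *)
Definition aeq (f g : X -> K) : Prop :=
  (\int[mu]_(x in D `&` [set x | f x <> g x]) (u x)%:E = 0)%E.

Let mD : measurable D := measurable_weight_dom u.
Let mu_ : measurable_fun D u := measurable_weight u.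
Let p0 : 0 < p. Proof. by []. Qed.

Lemma measurable_modulus (f : X -> K) :
  measurable_fun D (re_part \o f) -> measurable_fun D (im_part \o f) ->
  measurable_fun D (fun x => modulus (f x)).
Proof.
move=> mre mim.
under eq_fun do rewrite modulusE.
apply: (@measurableT_comp _ _ _ _ _ _ (@Num.sqrt R)).
  apply: continuous_measurable_fun; exact: sqrt_continuous.
by apply: measurable_funD; apply: measurable_funX.
Qed.

Lemma pdens_ge0 (f : X -> K) x : D x -> (0 <= (modulus (f x) `^ p * u x)%:E)%E.
Proof. by move=> Dx; rewrite lee_fin mulr_ge0 ?powR_ge0 ?weight_ge0. Qed.

Lemma pmass_ge0 (f : X -> K) : (0 <= pmass f)%E.
Proof. by rewrite power_integral.unlock; apply: integral_ge0 => x; exact: pdens_ge0. Qed.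

Lemma measurable_pdens (f : X -> K) :
  measurable_fun D (re_part \o f) -> measurable_fun D (im_part \o f) ->
  measurable_fun D (fun x => (modulus (f x) `^ p * u x)%:E).
Proof.
move=> mre mim; apply/measurable_EFinP/measurable_funM => //.
apply: (@measurableT_comp _ _ _ _ _ _ (@powR R ^~ p)) => //.
exact: measurable_modulus.
Qed.

Lemma pmass_le (c : R) (f g h : X -> K) : mem_Lq g -> mem_Lq h ->
  measurable_fun D (re_part \o f) -> measurable_fun D (im_part \o f) ->
  0 <= c ->
  (forall x, D x -> modulus (f x) `^ p <=
    c * (modulus (g x) `^ p + modulus (h x) `^ p)) ->
  (pmass f <= c%:E * (pmass g + pmass h))%E.
Proof.
move=> [gr gi _] [hr hi _] fr fi c0 le_f.
have mg := measurable_pdens gr gi; have mh := measurable_pdens hr hi.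
rewrite power_integral.unlock -ge0_integralD//; [|exact: pdens_ge0..].
rewrite -ge0_integralZl_EFin//; last 2 first.
- by move=> x Dx; rewrite adde_ge0// pdens_ge0.
- exact: emeasurable_funD.
apply: ge0_le_integral => //.
- by move=> x; exact: pdens_ge0.
- exact: measurable_pdens.
- apply: emeasurable_funM; first exact: measurable_cst.
  exact: emeasurable_funD.
- move=> x Dx; rewrite lee_fin -mulrDl mulrA.
  by apply: ler_wpM2r; [exact: weight_ge0|exact: le_f].
Qed.

Let pmass_lty (c : R) (g h : X -> K) : 0 <= c -> mem_Lq g -> mem_Lq h ->
  (c%:E * (pmass g + pmass h) < +oo)%E.
Proof.
move=> c0 [_ _ gy] [_ _ hy].
move: (pmass g) (pmass h) (pmass_ge0 g) (pmass_ge0 h) gy hy => m n m0 n0 my ny.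
by rewrite lte_mul_pinfty//; exact: lte_add_pinfty.
Qed.

Lemma mem_Lq_cst0 : mem_Lq (fun=> 0).
Proof.
split.
- by rewrite (_ : _ \o _ = cst 0)//; apply/funext => x /=; rewrite re_part0.
- by rewrite (_ : _ \o _ = cst 0)//; apply/funext => x /=; rewrite im_part0.
rewrite power_integral.unlock; under eq_integral do
  rewrite modulus0 powR0 ?gt_eqF// mul0r.
by rewrite integral0.
Qed.

Lemma mem_LqD f g : mem_Lq f -> mem_Lq g -> mem_Lq (fun x => f x + g x).
Proof.
move=> hf hg; have [fr fi ffin] := hf; have [gr gi gfin] := hg.
have sr : measurable_fun D (re_part \o (fun x => f x + g x)).
  rewrite (_ : _ \o _ = (re_part \o f) \+ (re_part \o g)).
    exact: measurable_funD.
  by apply/funext => x /=; rewrite re_partD.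
have si : measurable_fun D (im_part \o (fun x => f x + g x)).
  rewrite (_ : _ \o _ = (im_part \o f) \+ (im_part \o g)).
    exact: measurable_funD.
  by apply/funext => x /=; rewrite im_partD.
split; [exact: sr|exact: si|]; apply: (le_lt_trans (pmass_le hf hg sr si (powR_ge0 2 p) _)).
  move=> x _; apply: le_trans (powR_quasiadd (modulus_ge0 _) (modulus_ge0 _) p0).
  apply: ge0_ler_powR; last exact: modulusD.
  - exact: ltW.
  - by rewrite nnegrE modulus_ge0.
  - by rewrite nnegrE addr_ge0 ?modulus_ge0.
exact: (pmass_lty (powR_ge0 _ _)).
Qed.

Lemma mem_LqZ c f : mem_Lq f -> mem_Lq (fun x => c * f x).
Proof.
move=> hf; have [fr fi ffin] := hf.
have sr : measurable_fun D (re_part \o (fun x => c * f x)).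
  rewrite (_ : _ \o _ = (fun x => re_part c * (re_part \o f) x
                              - im_part c * (im_part \o f) x)).
    by apply: measurable_funB; apply: measurable_funM.
  by apply/funext => x /=; rewrite re_partM.
have si : measurable_fun D (im_part \o (fun x => c * f x)).
  rewrite (_ : _ \o _ = (fun x => re_part c * (im_part \o f) x
                              + im_part c * (re_part \o f) x)).
    by apply: measurable_funD; apply: measurable_funM.
  by apply/funext => x /=; rewrite im_partM.
split; [exact: sr|exact: si|].
apply: (le_lt_trans (pmass_le hf hf sr si (powR_ge0 (modulus c) p) _)).
  move=> x _; rewrite modulusM powRM ?modulus_ge0// ler_wpM2l ?powR_ge0//.
  by rewrite lerDl powR_ge0.
exact: (pmass_lty (powR_ge0 _ _)).
Qed.

Lemma mem_Lq_restrict A f : measurable A -> mem_Lq f ->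
  mem_Lq (patch (fun=> 0) A f).
Proof.
move=> mA hf; have [fr fi ffin] := hf.
have aux (h : X -> R) : measurable_fun D h ->
    measurable_fun D (fun x => if x \in A then h x else 0).
  move=> mh; apply: measurable_fun_if => //.
  - apply: (@measurable_fun_bool _ _ _ _ true).
    rewrite (_ : _ @^-1` _ = A); first exact: measurableI.
    by apply/seteqP; split => x /=; [move/set_mem|move/mem_set].
  - apply: measurable_funS mh => //; exact: subIsetl.
have sr : measurable_fun D (re_part \o patch (fun=> 0) A f).
  rewrite (_ : _ \o _ = (fun x => if x \in A then (re_part \o f) x else 0)).
    exact: aux.
  by apply/funext => x; rewrite /patch /=; case: ifP => // _; rewrite re_part0.
have si : measurable_fun D (im_part \o patch (fun=> 0) A f).
  rewrite (_ : _ \o _ = (fun x => if x \in A then (im_part \o f) x else 0)).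
    exact: aux.
  by apply/funext => x; rewrite /patch /=; case: ifP => // _; rewrite im_part0.
split; [exact: sr|exact: si|].
apply: (le_lt_trans (pmass_le hf hf sr si ler01 _)).
  move=> x _; rewrite mul1r /patch; case: ifP => _; first by rewrite lerDl powR_ge0.
  by rewrite modulus0 powR0 ?gt_eqF// addr_ge0// powR_ge0.
exact: pmass_lty.
Qed.

Definition Lqfun0 := MkLqfun mem_Lq_cst0.
Definition Lqfun_add (f g : Lqfun) := MkLqfun (mem_LqD (Lqfun_mem f) (Lqfun_mem g)).
Definition Lqfun_scale (c : K) (f : Lqfun) := MkLqfun (mem_LqZ c (Lqfun_mem f)).
Definition Lqfun_restrict A (mA : measurable A) (f : Lqfun) :=
  MkLqfun (mem_Lq_restrict mA (Lqfun_mem f)).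

Lemma aeqP (f g : Lqfun) :
  aeq f g <-> {ae mu, forall x, D x -> u x = 0 \/ f x = g x}.
Proof.
set h := Lqfun_add f (Lqfun_scale (-1) g).
have hP x : modulus (h x) = 0 <-> f x = g x.
  have -> : h x = f x - g x by rewrite /h/= mulN1r.
  split=> [/modulus_eq0/eqP|->]; last by rewrite subrr modulus0.
  by rewrite subr_eq0 => /eqP.
pose N := D `&` [set x | f x <> g x].
have mN : measurable N.
  have [hr hi _] := Lqfun_mem h.
  have mm := measurable_modulus hr hi.
  rewrite (_ : N = D `&` (fun x => modulus (h x)) @^-1` ~` [set 0]).
    by apply: mm => //; exact: measurableC.
  by apply/seteqP; split => x [Dx fg]; split => // ?; apply: fg; exact/hP.
have muN : measurable_fun N (EFin \o u).
  by apply/measurable_EFinP; apply: measurable_funS mu_ => //; exact: subIsetl.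
have -> : aeq f g <-> (\int[mu]_(x in N) `|(EFin \o u) x|)%E = 0%E.
  rewrite /aeq -/N.
  rewrite (_ : (\int[mu]_(x in N) `|(EFin \o u) x|)%E =
               (\int[mu]_(x in N) (u x)%:E)%E)//.
  apply: eq_integral => x; rewrite inE => -[Dx _].
  by rewrite /= ger0_norm// weight_ge0.
rewrite ae_eq_integral_abs//; split; apply: filterS => x /=.
  move=> H Dx; have [fg|fg] := pselect (f x = g x); [by right|left].
  by have [] : (u x)%:E = 0%E by exact: H.
by move=> H [Dx fg]; have [->|] := H Dx.
Qed.

Let aeqb (f g : Lqfun) : bool := `[< aeq f g >].

Let aeqb_refl : reflexive aeqb.
Proof. by move=> f; apply/asboolP/aeqP/aeW => x _; right. Qed.

Let aeqb_sym : symmetric aeqb.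
Proof.
by move=> f g; apply/idP/idP => /asboolP/aeqP fg; apply/asboolP/aeqP;
  by apply: filterS fg => x H Dx; case: (H Dx) => [?|->]; [left|right].
Qed.

Let aeqb_trans : transitive aeqb.
Proof.
move=> g f h /asboolP/aeqP fg /asboolP/aeqP gh; apply/asboolP/aeqP.
apply: filterS2 fg gh => x H1 H2 Dx.
have [|->] := H1 Dx; [by left|]; have [|->] := H2 Dx; [by left|by right].
Qed.

HB.instance Definition _ := gen_eqMixin Lqfun.
HB.instance Definition _ := gen_choiceMixin Lqfun.

Canonical aeq_equiv := EquivRel aeqb aeqb_refl aeqb_sym aeqb_trans.

Definition Lq : Type := {eq_quot aeq_equiv}.
HB.instance Definition _ := Choice.on Lq.
HB.instance Definition _ := EqQuotient.on Lq.

Definition Lq_class (f : Lqfun) : Lq := \pi_Lq%qT f.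

Local Notation aeD P := {ae mu, forall t, D t -> u t = 0 \/ P t}.

Lemma Lq_classP f g : Lq_class f = Lq_class g <-> aeD (fun t => f t = g t).
Proof.
rewrite -aeqP; split=> [/eqP|fg]; first by rewrite eqmodE => /asboolP.
by apply/eqP; rewrite eqmodE; apply/asboolP.
Qed.

Lemma Lq_reprK (x : Lq) : Lq_class (repr x) = x.
Proof. exact: reprK. Qed.

Lemma Lq_eqP (x y : Lq) : x = y <-> aeD (fun t => repr x t = repr y t).
Proof. by rewrite -Lq_classP !Lq_reprK. Qed.

Lemma repr_Lq_class f : aeD (fun t => repr (Lq_class f) t = f t).
Proof. by apply/Lq_classP; rewrite Lq_reprK. Qed.

Definition Lq_zero : Lq := Lq_class Lqfun0.
Definition Lq_add (x y : Lq) : Lq := Lq_class (Lqfun_add (repr x) (repr y)).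
Definition Lq_scale (c : K) (x : Lq) : Lq := Lq_class (Lqfun_scale c (repr x)).
Definition Lq_opp (x : Lq) : Lq := Lq_scale (-1) x.

Lemma Lqfun_ext (f g : Lqfun) : (forall x, f x = g x) -> f = g.
Proof.
case: f g => [f hf] [g hg] /= /funext fg; case: _ / fg hg => hg.
by rewrite (Prop_irrelevance hf hg).
Qed.

Lemma Lq_addE f g :
  Lq_add (Lq_class f) (Lq_class g) = Lq_class (Lqfun_add f g).
Proof.
apply/Lq_classP; apply: filterS2 (repr_Lq_class f) (repr_Lq_class g) => t ft gt.
by move=> Dt /=; case: (ft Dt) => [|->]; case: (gt Dt) => [|->]; auto.
Qed.

Lemma Lq_scaleE c f : Lq_scale c (Lq_class f) = Lq_class (Lqfun_scale c f).
Proof.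
apply/Lq_classP; apply: filterS (repr_Lq_class f) => t ft.
by move=> Dt /=; case: (ft Dt) => [|->]; auto.
Qed.

Lemma Lq_oppE f : Lq_opp (Lq_class f) = Lq_class (Lqfun_scale (-1) f).
Proof. exact: Lq_scaleE. Qed.

Let Lq_addA : associative Lq_add.
Proof.
move=> x y z; rewrite -[x]Lq_reprK -[y]Lq_reprK -[z]Lq_reprK !Lq_addE.
by congr Lq_class; apply: Lqfun_ext => t /=; rewrite addrA.
Qed.

Let Lq_addC : commutative Lq_add.
Proof.
move=> x y; rewrite -[x]Lq_reprK -[y]Lq_reprK !Lq_addE.
by congr Lq_class; apply: Lqfun_ext => t /=; rewrite addrC.
Qed.

Let Lq_add0 : left_id Lq_zero Lq_add.
Proof.
move=> x; rewrite -[x]Lq_reprK !Lq_addE.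
by congr Lq_class; apply: Lqfun_ext => t /=; rewrite add0r.
Qed.

Let Lq_addN : left_inverse Lq_zero Lq_opp Lq_add.
Proof.
move=> x; rewrite -[x]Lq_reprK Lq_oppE !Lq_addE.
by congr Lq_class; apply: Lqfun_ext => t /=; rewrite mulN1r addNr.
Qed.

HB.instance Definition _ :=
  GRing.isZmodule.Build Lq Lq_addA Lq_addC Lq_add0 Lq_addN.

Let Lq_scaleA a b x : Lq_scale a (Lq_scale b x) = Lq_scale (a * b) x.
Proof.
rewrite -[x]Lq_reprK !Lq_scaleE.
by congr Lq_class; apply: Lqfun_ext => t /=; rewrite mulrA.
Qed.

Let Lq_scale1 : left_id 1 Lq_scale.
Proof.
move=> x; rewrite -[x]Lq_reprK !Lq_scaleE.
by congr Lq_class; apply: Lqfun_ext => t /=; rewrite mul1r.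
Qed.

Let Lq_scaleDr : right_distributive Lq_scale +%R.
Proof.
move=> a x y; rewrite -[x]Lq_reprK -[y]Lq_reprK.
rewrite -[_ + _]/(Lq_add _ _) -[RHS]/(Lq_add _ _) Lq_addE !Lq_scaleE Lq_addE.
by congr Lq_class; apply: Lqfun_ext => t /=; rewrite mulrDr.
Qed.

Let Lq_scaleDl x : {morph Lq_scale^~ x : a b / a + b}.
Proof.
move=> a b; rewrite -[x]Lq_reprK -[RHS]/(Lq_add _ _) !Lq_scaleE Lq_addE.
by congr Lq_class; apply: Lqfun_ext => t /=; rewrite mulrDl.
Qed.

HB.instance Definition _ := GRing.Zmodule_isLmodule.Build K Lq
  Lq_scaleA Lq_scale1 Lq_scaleDr Lq_scaleDl.

Lemma Lq_classD f g : Lq_class (Lqfun_add f g) = Lq_class f + Lq_class g.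
Proof. by rewrite -Lq_addE. Qed.

Lemma Lq_classZ c f : Lq_class (Lqfun_scale c f) = c *: Lq_class f.
Proof. by rewrite -Lq_scaleE. Qed.

Lemma Lq_class0 : Lq_class Lqfun0 = 0.
Proof. by []. Qed.

Definition Lq_norm (x : Lq) : R := fine (pmass (repr x)) `^ p^-1.

Lemma pmass_class f : pmass (repr (Lq_class f)) = pmass f.
Proof.
have [hr hi _] := Lqfun_mem (repr (Lq_class f)); have [fr fi _] := Lqfun_mem f.
rewrite power_integral.unlock; apply: ae_eq_integral => //; [exact: measurable_pdens..|].
apply: filterS (repr_Lq_class f) => t ft Dt.
by case: (ft Dt) => ->; rewrite ?mulr0.
Qed.

Lemma Lq_norm_class f : Lq_norm (Lq_class f) = fine (pmass f) `^ p^-1.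
Proof. by rewrite /Lq_norm pmass_class. Qed.

Lemma Lq_norm_ge0 x : 0 <= Lq_norm x.
Proof. exact: powR_ge0. Qed.

Lemma Lqfun_pmass_fin (f : Lqfun) : pmass f \is a fin_num.
Proof. by rewrite ge0_fin_numE ?pmass_ge0//; case: (Lqfun_mem f). Qed.

Lemma Lq_normX x : Lq_norm x `^ p = fine (pmass (repr x)).
Proof. by rewrite -powRrM mulVf ?gt_eqF// powRr1// fine_ge0// pmass_ge0. Qed.

Lemma LqP (x : Lq) : exists f, x = Lq_class f.
Proof. by exists (repr x); rewrite Lq_reprK. Qed.

Lemma Lq_norm0 : Lq_norm 0 = 0.
Proof.
rewrite -Lq_class0 Lq_norm_class power_integral.unlock/=.
under eq_integral do rewrite modulus0 powR0 ?gt_eqF// mul0r.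
by rewrite integral0 powR0// invr_eq0 gt_eqF.
Qed.

Lemma Lq_norm_eq0 x : Lq_norm x = 0 -> x = 0.
Proof.
move=> x0; have := Lq_normX x; rewrite x0 powR0 ?gt_eqF// => /esym/eqP.
rewrite fine_eq0 ?Lqfun_pmass_fin// => /eqP px0.
have [hr hi _] := Lqfun_mem (repr x).
have : (\int[mu]_(t in D) `|(modulus (repr x t) `^ p * u t)%:E| = 0)%E.
  rewrite -[RHS]px0 power_integral.unlock; apply: eq_integral => t; rewrite inE => Dt.
  by rewrite gee0_abs// pdens_ge0.
rewrite ae_eq_integral_abs//; last exact: measurable_pdens.
move=> H; rewrite -[x]Lq_reprK -Lq_class0; apply/Lq_classP.
apply: filterS H => t H Dt; have [/eqP] : (modulus (repr x t) `^ p * u t)%:E = 0%E.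
  exact: H.
rewrite mulf_eq0 => /orP[/eqP/powR_eq0_eq0 h|/eqP ->]; [right|by left].
exact/modulus_eq0.
Qed.

Lemma Lq_normN x : Lq_norm (- x) = Lq_norm x.
Proof.
rewrite -[x]Lq_reprK -scaleN1r -Lq_classZ !Lq_norm_class.
have -> // : pmass (Lqfun_scale (-1) (repr x)) = pmass (repr x).
rewrite power_integral.unlock.
by apply: eq_integral => t _ /=; rewrite mulN1r modulusN.
Qed.

Let Lq_normD_le1 x y : p <= 1 ->
  Lq_norm (x + y) `^ p <= Lq_norm x `^ p + Lq_norm y `^ p.
Proof.
move=> p1; have [f ->] := LqP x; have [g ->] := LqP y.
rewrite -Lq_classD !Lq_normX !pmass_class.
rewrite -lee_fin EFinD !fineK; [|exact: Lqfun_pmass_fin..].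
rewrite -[leRHS]mul1e.
have [fr fi _] := Lqfun_mem (Lqfun_add f g).
apply: (pmass_le (Lqfun_mem f) (Lqfun_mem g) fr fi ler01) => t Dt /=.
rewrite mul1r; apply: (@le_trans _ _ ((modulus (f t) + modulus (g t)) `^ p)).
  apply: ge0_ler_powR; last exact: modulusD.
  - exact: ltW.
  - by rewrite nnegrE modulus_ge0.
  - by rewrite nnegrE addr_ge0 ?modulus_ge0.
by apply: powR_subadd; rewrite ?modulus_ge0// p0.
Qed.

Let wfun (f : X -> K) (t : X) : R :=
  if t \in D then modulus (f t) * u t `^ p^-1 else 0.

Let measurable_wfun (f : Lqfun) : measurable_fun setT (wfun f).
Proof.
have [fr fi _] := Lqfun_mem f.
apply/(measurable_restrictT (fun t => modulus (f t) * u t `^ p^-1) mD).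
apply: measurable_funM; first exact: measurable_modulus.
exact: (@measurableT_comp _ _ _ _ _ _ (@powR R ^~ p^-1)).
Qed.

Let wfun_powR f t : D t -> wfun f t `^ p = modulus (f t) `^ p * u t.
Proof.
move=> Dt; rewrite /wfun mem_set// powRM ?modulus_ge0 ?powR_ge0//.
by rewrite -powRrM mulVf ?gt_eqF// powRr1// weight_ge0.
Qed.

Let wfun_ge0 f t : 0 <= wfun f t.
Proof. by rewrite /wfun; case: ifP => // _; rewrite mulr_ge0 ?modulus_ge0 ?powR_ge0. Qed.

Let Lnorm_wfun (f : Lqfun) :
  'N[mu]_(p%:E)[EFin \o wfun f]%E = (fine (pmass f) `^ p^-1)%:E.
Proof.
rewrite Lnorm.unlock /= -poweR_EFin fineK; last exact: Lqfun_pmass_fin.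
congr (_ `^ _)%E; rewrite [in RHS]power_integral.unlock [RHS]integral_mkcond.
apply: eq_integral => t _ /=; rewrite /patch.
case: ifPn => [|/negP]; rewrite inE => Dt.
  by rewrite ger0_norm ?wfun_ge0// wfun_powR.
by rewrite /wfun memNset// normr0 powR0// gt_eqF.
Qed.

Let Lq_normD_ge1 x y : 1 <= p -> Lq_norm (x + y) <= Lq_norm x + Lq_norm y.
Proof.
move=> p1; have [f ->] := LqP x; have [g ->] := LqP y.
rewrite -Lq_classD 3!Lq_norm_class -lee_fin EFinD -3!Lnorm_wfun.
apply: le_trans (minkowski_EFin mu (measurable_wfun f) (measurable_wfun g) p1).
rewrite Lnorm.unlock /=.
have mW (h : X -> R) : measurable_fun setT h ->
    measurable_fun setT (fun t => `|(h t)%:E| `^ p)%E.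
  move=> mh; apply: (@measurableT_comp _ _ _ _ _ _ (fun x => x `^ p)%E) => //.
    exact: measurable_poweR.
  exact/measurableT_comp/measurable_EFinP.
apply: gt0_ler_poweR.
- by rewrite invr_ge0 ltW.
- by rewrite in_itv/= leey andbT integral_ge0// => t _; exact: poweR_ge0.
- by rewrite in_itv/= leey andbT integral_ge0// => t _; exact: poweR_ge0.
apply: ge0_le_integral => //.
- exact: (mW _ (measurable_wfun (Lqfun_add f g))).
- exact: (mW _ (measurable_funD (measurable_wfun f) (measurable_wfun g))).
- move=> t _; rewrite lee_fin.
  apply: ge0_ler_powR; [exact: ltW|by rewrite nnegrE..|].
  rewrite !ger0_norm ?addr_ge0 ?wfun_ge0// /wfun.
  case: ifP => _; last by rewrite addr0.
  by rewrite -mulrDl ler_wpM2r ?powR_ge0// modulusD.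
Qed.

Definition vartheta : R := Order.min 1 p.

Lemma vartheta_gt0 : 0 < vartheta.
Proof. by rewrite lt_min ltr01 p0. Qed.

Lemma Lq_normD_vartheta x y :
  Lq_norm (x + y) `^ vartheta <= Lq_norm x `^ vartheta + Lq_norm y `^ vartheta.
Proof.
rewrite /vartheta; case: (leP 1 p) => p1; last exact/Lq_normD_le1/ltW.
by rewrite 3?powRr1 ?Lq_norm_ge0//; exact: Lq_normD_ge1.
Qed.

Definition Lq_dist (x y : Lq) : R := Lq_norm (x - y) `^ vartheta.

Let Lq_distxx x : Lq_dist x x = 0.
Proof. by rewrite /Lq_dist subrr Lq_norm0 powR0// gt_eqF// vartheta_gt0. Qed.

Let Lq_dist_eq0 x y : Lq_dist x y = 0 -> x = y.
Proof.
by move=> /powR_eq0_eq0/Lq_norm_eq0/eqP; rewrite subr_eq0 => /eqP.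
Qed.

Let Lq_dist_sym x y : Lq_dist x y = Lq_dist y x.
Proof. by rewrite /Lq_dist -opprB Lq_normN. Qed.

Let Lq_dist_triangle y x z : Lq_dist x z <= Lq_dist x y + Lq_dist y z.
Proof. by rewrite /Lq_dist -(subrKA y) Lq_normD_vartheta. Qed.

HB.instance Definition _ := isMetric.Build R Lq
  Lq_distxx Lq_dist_eq0 Lq_dist_sym Lq_dist_triangle.

Definition Lq_restrict A (mA : measurable A) (x : Lq) : Lq :=
  Lq_class (Lqfun_restrict mA (repr x)).

Lemma Lq_restrict_class A (mA : measurable A) f :
  Lq_restrict mA (Lq_class f) = Lq_class (Lqfun_restrict mA f).
Proof.
apply/Lq_classP; apply: filterS (repr_Lq_class f) => t ft Dt.
by case: (ft Dt) => [|E]; [left|right; rewrite /= /patch E].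
Qed.

End Lq.
Arguments vartheta {R} q.

Section lebesgue.
Variable R : realType.

(* R with the sigma-algebra of Lebesgue (not only Borel) measurable sets *)
Definition lebesgueT : measurableType _ :=
  caratheodory_type (@wlength R idfun)^*%mu.

Definition lebesgue : {measure set lebesgueT -> \bar R} :=
  @completed_lebesgue_measure R.

Definition ivl (a b : \bar R) : set lebesgueT := [set x : R | (a < x%:E < b)%E].

Lemma measurable_ivl a b : measurable (ivl a b).
Proof.
apply: sub_caratheodory.
have : measurable (setT `&` (@EFin R) @^-1` [set` `]a, b[]).
  by apply: EFin_measurable => //; exact: emeasurable_itv.
by rewrite setTI (_ : _ @^-1` _ = ivl a b).
Qed.

Definition loc_integrable (a b : \bar R) (u : R -> R) : Prop :=
  forall A : set R, A `<=` ivl a b -> compact A ->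
    (\int[lebesgue]_(x in A) `|u x|%:E < +oo)%E.

(* For a < b the values left_end +oo and right_end -oo are never reached. *)
Definition left_end (a : \bar R) : set_system R :=
  if a is x%:E then x^'+ else ninfty_nbhs R.

Definition right_end (b : \bar R) : set_system R :=
  if b is x%:E then x^'- else pinfty_nbhs R.

End lebesgue.

Section bilinear_maps.
Variables (R : realType) (a b : \bar R) (u : weight R (ivl a b)).
Variables (q : {posnum R}) (k : scalar_kind).
Variables E1 E2 : normedModType (scalar_field R k).
Local Notation Y := (Lq (lebesgue R) u q k).
Implicit Types (f : E1 -> E2 -> Y) (A : set Y).

Definition unit_balls : set (E1 * E2) := [set x | `|x.1| <= 1 /\ `|x.2| <= 1].

Definition ball_image f : set Y := [set f x.1 x.2 | x in unit_balls].

Definition op_norm f : \bar R :=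
  ereal_sup [set (Lq_norm y)%:E | y in ball_image f].

Definition bounded_map f : Prop := (op_norm f < +oo)%E.

Definition compact_map f : Prop := compact (closure (ball_image f)).

Definition ess_norm f : \bar R :=
  ereal_inf [set op_norm (fun x y => f x y - K x y) |
    K in [set K : {bilinear E1 -> E2 -> Y} | compact_map K]].

Definition ess_vartheta f : \bar R :=
  ereal_inf [set (op_norm (fun x y => f x y - K x y)%R `^ vartheta q)%E |
    K in [set K : {bilinear E1 -> E2 -> Y} | compact_map K]].

Definition chi_Y A : \bar R :=
  ereal_inf [set e%:E | e in [set e : R | 0 < e /\ exists s : seq Y,
    A `<=` \bigcup_(y in [set` s]) [set z | Lq_norm (z - y) < e]]].

Definition chi_rho A : \bar R :=
  ereal_inf [set e%:E | e in [set e : R | 0 < e /\ exists s : seq Y,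
    A `<=` \bigcup_(y in [set` s]) [set z | Lq_dist z y < e]]].

Definition restrict_map S (mS : measurable S) f : E1 -> E2 -> Y :=
  fun x y => Lq_restrict mS (f x y).

Definition truncation c d f := restrict_map (measurable_ivl c%:E d%:E) f.

Definition alpha_T f (c : R) : \bar R :=
  op_norm (restrict_map (measurable_ivl a c%:E) f).

Definition beta_T f (d : R) : \bar R :=
  op_norm (restrict_map (measurable_ivl d%:E b) f).

Definition gamma_T f (c d : R) : \bar R :=
  op_norm (restrict_map
    (measurableU _ _ (measurable_ivl a c%:E) (measurable_ivl d%:E b)) f).

Definition tau_T f : \bar R :=
  ereal_inf [set t | exists c d : R, [/\ (a < c%:E)%E, c < d, (d%:E < b)%E &
    t = gamma_T f c d]].

End bilinear_maps.

(* Main.v *)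
(* Subtracting the compact map chi_(c,d) T leaves chi_((a,c) u (d,b)) T, so
   the essential norm of T is at most tau(T).  A finite cover of K(D_E) by
   small balls, K compact, turns into a finite cover of T(D_E) by balls of
   radius about ||T - K||, so chi_Y(T(D_E)) is at most the essential norm.
   Finally, the finitely many centres of a cover of T(D_E) have small tails
   near a and b, so the tails of T are bounded by the radius of the cover,
   and tau(T) is at most chi_Y(T(D_E)).  If tau(T) = 0 then T(D_E) is totally
   bounded, and its closure is compact because L^q is complete. *)
Require Import Defs.
From HB Require Import structures.
From mathcomp Require Import all_boot all_order all_algebra.
From mathcomp Require Import all_classical all_reals all_analysis.
From mathcomp Require Import measurable_realfun complex.
From mathcomp Require Import lra.
Import Order.TTheory GRing.Theory Num.Theory.
Import numFieldNormedType.Exports.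

Set Implicit Arguments.
Unset Strict Implicit.
Unset Printing Implicit Defensive.

Local Open Scope classical_set_scope.
Local Open Scope ring_scope.

(** * Totally bounded sets *)

Section total_boundedness.
Context {R : realType} {X : pseudoMetricType R}.
Implicit Types A : set X.

Definition totally_bounded A := forall e : R, 0 < e ->
  exists s : seq X, A `<=` \bigcup_(y in [set` s]) ball y e.

Lemma compact_totally_bounded A : compact A -> totally_bounded A.
Proof.
move=> /compact_near_coveringP cA e e0.
(* Near-covering along the filter of finite subsets of X. *)
pose F := filter_from [set: seq X] (fun s => [set t : seq X | {subset s <= t}]).
have FF : Filter F.
  apply: filter_from_filter => [|s t _ _]; first by exists [::].
  exists (s ++ t) => // r rst; split => x xs; apply: rst;
    by rewrite mem_cat xs ?orbT.
have [|s _ /(_ s (fun=> id)) sA] :=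
    cA _ F (fun s x => exists2 y, y \in s & ball y e x) FF.
  move=> x _; exists (ball x e, [set t : seq X | x \in t]) => /=.
    split; first exact: nbhsx_ballx.
    by exists [:: x] => // t xt; apply: xt; rewrite mem_head.
  by move=> [y t] /= [xy xt]; exists x.
by exists s => x /sA [y ys yx]; exists y.
Qed.

(** An ultrafilter contains [B i] or its complement. In the second case intersecting with the
    complement removes [B i] from the union, and the induction goes on; it cannot reach the empty
    union because the filter is proper. *)
Lemma ultra_bigcup_seq {I : eqType} (F : set_system X) (s : seq I)
    (B : I -> set X) : UltraFilter F -> F (\bigcup_(i in [set` s]) B i) ->
  exists i, F (B i).
Proof.
move=> UF; elim: s => [|i s IH].
  by move=> /filter_ex[x []].
move=> FU; have [|FC] := in_ultra_setVsetC (B i) UF; first by exists i.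
apply: IH; apply: filterS (filterI FU FC) => x [[j /= jis Bjx] nBix].
by move: jis; rewrite inE => /predU1P[ji|js]; [rewrite ji in Bjx|exists j].
Qed.

(** Compactness is tested on ultrafilters containing the closure. A finite cover by small balls puts
    one of the balls in the ultrafilter, which is therefore Cauchy. Completeness enters as a
    hypothesis on filters, the form in which [Lq_complete] supplies it. *)
Lemma totally_bounded_compact_closure A :
  (forall F : set_system X, ProperFilter F -> cauchy F ->
    exists p : X, F --> p) ->
  totally_bounded A -> compact (closure A).
Proof.
move=> complete tbA; rewrite compact_ultra => F UF FA.
suff /complete[p Fp] : cauchy F.
  exists p; split=> //; apply: closed_closure => B /Fp FB.
  exact: filter_ex (filterI FA FB).
apply: cauchy_exP => e e0; have e20 : 0 < e / 2 by rewrite divr_gt0.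
have [s As] := tbA _ e20.
(* Balls of radius [e / 2] cover [A]; with the radius doubled the same centres cover its closure. *)
apply: (@ultra_bigcup_seq _ F s (fun y => ball y e)).
apply: filterS FA => x /(_ _ (nbhsx_ballx x _ e20))[z [/As[y ys yz] xz]].
exists y => //; rewrite [e]splitr; apply: ball_triangle yz _; exact: ball_sym.
Qed.

End total_boundedness.

(** * Sequences with geometrically decaying increments *)

Lemma cvg_half_pow {R : realType} (C : R) :
  C / 2 ^+ n @[n --> \oo] --> (0 : R).
Proof.
rewrite -[0](mulr0 C); under eq_fun do rewrite -exprVn.
apply: cvgMr; apply: cvg_expr.
by rewrite ger0_norm ?invr_ge0// invf_lt1// ltr1n.
Qed.

Lemma half_pow_small {R : realType} (C e : R) : 0 <= C -> 0 < e ->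
  exists n, C / 2 ^+ n < e.
Proof.
move=> C0 e0; have /cvgrPdist_lt/(_ e e0)[n _ Hn] := @cvg_half_pow R C.
exists n; have := Hn n (leqnn n).
by rewrite /= sub0r normrN ger0_norm// divr_ge0 ?exprn_ge0.
Qed.

Lemma geometric_cvg {R : realType} (a : nat -> R) (C : R) :
  (forall n, `|a n.+1 - a n| <= C / 2 ^+ n) ->
  exists l, a @ \oo --> l /\ forall n, `|l - a n| <= 2 * C / 2 ^+ n.
Proof.
move=> aC.
have C0 : 0 <= C by have := le_trans _ (aC 0%N); rewrite divr1; apply.
(* Subtracting the tail at [m] makes the induction close: passing from [m] to [m.+1] increases the
   right-hand side by exactly [C / 2 ^+ m]. *)
have dist n m : (n <= m)%N -> `|a m - a n| <= 2 * C / 2 ^+ n - 2 * C / 2 ^+ m.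
  elim: m => [|m IH]; first by rewrite leqn0 => /eqP->; rewrite !subrr normr0.
  rewrite leq_eqVlt => /predU1P[->|/IH {}IH]; first by rewrite !subrr normr0.
  rewrite -(subrKA (a m)) (le_trans (ler_normD _ _))//.
  have -> : 2 * C / 2 ^+ m.+1 = C / 2 ^+ m.
    by rewrite exprS -mulf_div divff ?mul1r// pnatr_eq0.
  by have := aC m; lra.
have bound n m : (n <= m)%N -> `|a m - a n| <= 2 * C / 2 ^+ n.
  move=> nm; apply: le_trans (dist _ _ nm) _.
  by rewrite gerDl oppr_le0 divr_ge0 ?mulr_ge0 ?exprn_ge0.
have /cauchy_cvgP cva : cauchy (a @ \oo).
  apply: cauchy_exP => e e0.
  have [n Cn] := half_pow_small (mulr_ge0 (ler0n R 2) C0) e0.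
  exists (a n); exists n => // m /= nm; rewrite /ball/= distrC.
  exact: le_lt_trans (bound _ _ nm) Cn.
exists (lim (a @ \oo)); split=> // n.
apply: (@cvgr_to_le _ \oo _ _ (fun m => `|a m - a n|)).
  by apply: cvg_norm; apply: cvgB cva _; exact: cvg_cst.
by exists n => // m /= /bound.
Qed.

(** * Riesz-Fischer for L^q *)

Section scalar_limsup.
Context {R : realType} {k : scalar_kind}.
Implicit Types z : nat -> scalar_field R k.

Definition mk_scalar (x y : R) : scalar_field R k :=
  match k with RealScalars => x | ComplexScalars => (x +i* y)%C end.

(** A limit defined at every point: a limsup of measurable functions is measurable whether or not
    the sequence converges, and [fine] replaces infinite values by 0. Where both parts converge,
    this is the limit. *)
Definition scalar_limsup z : scalar_field R k :=
  mk_scalar (fine (limn_esup (EFin \o (re_part \o z))))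
            (fine (limn_esup (EFin \o (im_part \o z)))).

Lemma re_scalar_limsup z :
  re_part (scalar_limsup z) = fine (limn_esup (EFin \o (re_part \o z))).
Proof. by rewrite /scalar_limsup /mk_scalar; case: k z. Qed.

Lemma im_scalar_limsup z :
  im_part (scalar_limsup z) = fine (limn_esup (EFin \o (im_part \o z))).
Proof.
rewrite /scalar_limsup /mk_scalar; case: k z => //= z.
by rewrite (cvg_limn_einf_sup (cvg_cst 0%E)).2.
Qed.

Lemma re_partN (z : scalar_field R k) : re_part (- z) = - re_part z.
Proof. by case: k z => //= -[]. Qed.

Lemma im_partN (z : scalar_field R k) : im_part (- z) = - im_part z.
Proof. by case: k z => /= [_|[]//]; rewrite oppr0. Qed.

Lemma re_part_le_modulus (z : scalar_field R k) : `|re_part z| <= modulus z.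
Proof. by rewrite modulusE -sqrtr_sqr ler_wsqrtr// lerDl sqr_ge0. Qed.

Lemma im_part_le_modulus (z : scalar_field R k) : `|im_part z| <= modulus z.
Proof. by rewrite modulusE -[leLHS]sqrtr_sqr ler_wsqrtr// lerDr sqr_ge0. Qed.

Lemma modulus_le (z : scalar_field R k) :
  modulus z <= `|re_part z| + `|im_part z|.
Proof.
rewrite modulusE -[leRHS]ger0_norm ?addr_ge0// -[leRHS]sqrtr_sqr ler_wsqrtr//.
rewrite -[X in X + _]real_normK ?num_real// -[X in _ + X]real_normK ?num_real//.
by rewrite sqrrD -addrA lerD2l addrC lerDl mulrn_wge0// mulr_ge0.
Qed.

(** The geometric tail costs [2 * C / 2 ^+ n] for the real part and as much for the imaginary part,
    whence the 4. *)
Lemma scalar_limsup_dist z (C : R) :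
  (forall n, modulus (z n.+1 - z n) <= C / 2 ^+ n) ->
  forall n, modulus (scalar_limsup z - z n) <= 4 * C / 2 ^+ n.
Proof.
move=> zC n; apply: le_trans (modulus_le _) _.
rewrite re_partD im_partD re_partN im_partN re_scalar_limsup im_scalar_limsup.
have lim_dist (a : nat -> R) : (forall n, `|a n.+1 - a n| <= C / 2 ^+ n) ->
    `|fine (limn_esup (EFin \o a)) - a n| <= 2 * C / 2 ^+ n.
  move=> /geometric_cvg[l [al dl]].
  have ael : (EFin \o a) n @[n --> \oo] --> l%:E 
    by apply: cvg_EFin => //; exact: nearW.
  by rewrite (cvg_limn_einf_sup ael).2 dl.
have -> : 4 * C / 2 ^+ n = 2 * C / 2 ^+ n + 2 * C / 2 ^+ n by lra.
apply: lerD; apply: lim_dist => m /=; apply: le_trans (zC m).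
- by rewrite -re_partN -re_partD re_part_le_modulus.
- by rewrite -im_partN -im_partD im_part_le_modulus.
Qed.

End scalar_limsup.

(** * Comparison of real powers with positive exponent *)

Section powR_monotone.
Context {R : realType} {p : R}.
Hypothesis p0 : 0 < p.

Lemma ler_powR_pos s t : 0 <= s -> 0 <= t -> (s `^ p <= t `^ p) = (s <= t).
Proof.
move=> s0 t0; apply/idP/idP => [|st]; last first.
  by apply: ge0_ler_powR; rewrite ?nnegrE// ltW.
by rewrite !leNgt; apply: contra => ts; apply: gt0_ltr_powR; rewrite ?nnegrE.
Qed.

Lemma ltr_powR_pos s t : 0 <= s -> 0 <= t -> (s `^ p < t `^ p) = (s < t).
Proof. by move=> s0 t0; rewrite !ltNge ler_powR_pos. Qed.

Lemma powRVK s : 0 <= s -> (s `^ p^-1) `^ p = s.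
Proof. by move=> s0; rewrite -powRrM mulVf ?gt_eqF// powRr1. Qed.

End powR_monotone.

Section Lq_complete.
Context d (X : measurableType d) (R : realType).
Variables (mu : {measure set X -> \bar R}) (D : set X) (u : weight R D).
Variables (q : {posnum R}) (k : scalar_kind).
Local Notation p := (q%:num).
Local Notation Y := (Lq mu u q k).
Local Notation pmass := (power_integral mu D u p).
Local Notation N := (@Lq_norm _ _ _ mu D u q k).
Implicit Types (f g : Lqfun mu u q k) (x y z : Y).

Let mD : measurable D := measurable_weight_dom u.
Let p0 : 0 < p. Proof. by []. Qed.

Lemma Lq_normX_class f : N (Lq_class f) `^ p = fine (pmass f).
Proof. by rewrite Lq_normX pmass_class. Qed.

(* If h_n is the difference of consecutive terms, then the function
   G = sum_n (2^n |h_n|)^p u has finite integral, hence |h_n| <= C / 2^n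
   pointwise almost everywhere on {u <> 0} with C^p u = G.  The limit F then
   satisfies |F - f_n|^p u <= (4 / 2^n)^p G, for every p > 0. *)
Section fast.
Variable y : nat -> Y.
Hypothesis fast :
  forall n, N (y n.+1 - y n) `^ p <= (2 ^- n) `^ p * (1 / (2 ^ n.+1)%:R).

Let f n : Lqfun mu u q k := repr (y n).
Let h n : Lqfun mu u q k := Lqfun_add (f n.+1) (Lqfun_scale (-1) (f n)).

Let hE n t : h n t = f n.+1 t - f n t.
Proof. by rewrite /h /= mulN1r. Qed.

Let pmass_h n : (pmass (h n) <= ((2 ^- n) `^ p * (1 / (2 ^ n.+1)%:R))%:E)%E.
Proof.
rewrite -(fineK (Lqfun_pmass_fin _)) lee_fin -Lq_normX_class.
by rewrite Lq_classD Lq_classZ scaleN1r !Lq_reprK.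
Qed.

Let g n t : \bar R :=
  (((2 ^- n) `^ p)^-1%:E * (modulus (h n t) `^ p * u t)%:E)%E.
Let G t : \bar R := (\sum_(0 <= n <oo) g n t)%E.

Let g_ge0 n t : D t -> (0 <= g n t)%E.
Proof.
by move=> Dt; rewrite mule_ge0 ?pdens_ge0// lee_fin invr_ge0 powR_ge0.
Qed.

Let measurable_g n : measurable_fun D (g n).
Proof.
have [hr hi _] := Lqfun_mem (h n).
by apply: emeasurable_funM; [exact: measurable_cst|exact: measurable_pdens].
Qed.

Let G_ge0 t : D t -> (0 <= G t)%E.
Proof. by move=> Dt; apply: nneseries_ge0 => n _ _; exact: g_ge0. Qed.

Let measurable_G : measurable_fun D G.
Proof. by apply: ge0_emeasurable_sum => // n t Dt _; exact: g_ge0. Qed.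

Let integral_G : (\int[mu]_(t in D) G t <= 1)%E.
Proof.
rewrite integral_nneseries//; apply: le_trans (epsilon_trick0 xpredT ler01).
apply: lee_nneseries => [n _ _|n _].
  by apply: integral_ge0 => t; exact: g_ge0.
have [hr hi _] := Lqfun_mem (h n).
rewrite ge0_integralZl_EFin ?invr_ge0 ?powR_ge0//; last 2 first.
- by move=> t; exact: pdens_ge0.
- exact: measurable_pdens.
have := pmass_h n; rewrite power_integral.unlock => /(lee_wpmul2l _).
move=> /(_ ((2 ^- n) `^ p)^-1%:E).
rewrite lee_fin invr_ge0 powR_ge0 => /(_ isT).
move=> /le_trans; apply; rewrite -EFinM mulrA mulVf ?mul1r//.
Qed.

Let F t : scalar_field R k := scalar_limsup (fun n => f n t).

Let ae_bound : {ae mu, forall t, D t -> forall n,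
  ((modulus (F t - f n t) `^ p * u t)%:E <= ((4 / 2 ^+ n) `^ p)%:E * G t)%E}.
Proof.
have iG : mu.-integrable D G.
  apply/integrableP; split=> //.
  rewrite (eq_integral G) => [|t].
    by rewrite (le_lt_trans integral_G)// ltry.
  by rewrite inE => Dt; rewrite gee0_abs// G_ge0.
apply: filterS (integrable_ae mD iG) => t Gfin Dt n.
have {}Gfin := Gfin Dt; have u0 := weight_ge0 u Dt.
have [->|un0] := eqVneq (u t) 0.
  by rewrite mulr0 mule_ge0 ?G_ge0// lee_fin powR_ge0.
have {un0}u0 : 0 < u t by rewrite lt_neqAle eq_sym un0.
pose C := (fine (G t) / u t) `^ p^-1.
have G0 : 0 <= fine (G t) by rewrite fine_ge0// G_ge0.
have CX : C `^ p = fine (G t) / u t.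
  by rewrite powRVK// divr_ge0// ltW.
have hC m : modulus (f m.+1 t - f m t) <= C / 2 ^+ m.
  have gG : (g m t <= G t)%E.
    rewrite /G (@nneseriesD1 _ _ m)// => [|i _]; last exact: g_ge0.
    by rewrite leeDl// nneseries_ge0// => i _ _; exact: g_ge0.
  move: gG; rewrite -hE -(fineK Gfin) lee_fin => gG.
  rewrite -(ler_powR_pos p0) ?modulus_ge0 ?mulr_ge0 ?powR_ge0 ?invr_ge0
    ?exprn_ge0//.
  rewrite powRM ?powR_ge0 ?invr_ge0 ?exprn_ge0// CX mulrAC ler_pdivlMr//.
  rewrite [leRHS]mulrC -ler_pdivrMl ?powR_gt0 ?invr_gt0//.
rewrite -[G t]fineK// -EFinM lee_fin.
have /(_ n) := scalar_limsup_dist hC; rewrite -/(F t) => FC.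
have -> : fine (G t) = C `^ p * u t by rewrite CX divfK// gt_eqF.
rewrite mulrA -powRM ?powR_ge0 ?divr_ge0 ?exprn_ge0//.
apply: ler_wpM2r; first exact: ltW.
apply: ge0_ler_powR; rewrite ?nnegrE ?modulus_ge0 ?mulr_ge0 ?invr_ge0
  ?powR_ge0 ?exprn_ge0//.
by rewrite mulrAC.
Qed.

Let measurable_F : measurable_fun D (re_part \o F) /\
  measurable_fun D (im_part \o F).
Proof.
split.
  rewrite (_ : _ \o F =
      fine \o fun t => limn_esup (fun n => (re_part (f n t))%:E)).
    apply: measurableT_comp => //; apply: measurable_fun_limn_esup => n.
    by apply/measurable_EFinP; have [] := Lqfun_mem (f n).
  by apply/funext => t; exact: re_scalar_limsup.
rewrite (_ : _ \o F =
    fine \o fun t => limn_esup (fun n => (im_part (f n t))%:E)).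
  apply: measurableT_comp => //; apply: measurable_fun_limn_esup => n.
  by apply/measurable_EFinP; have [] := Lqfun_mem (f n).
by apply/funext => t; exact: im_scalar_limsup.
Qed.

Let measurable_dF n : measurable_fun D (re_part \o (fun t => F t - f n t)) /\
  measurable_fun D (im_part \o (fun t => F t - f n t)).
Proof.
have [Fr Fi] := measurable_F; have [fr fi _] := Lqfun_mem (f n); split.
  rewrite (_ : _ \o _ = (re_part \o F) \- (re_part \o f n)).
    exact: measurable_funB.
  by apply/funext => t /=; rewrite re_partD re_partN.
rewrite (_ : _ \o _ = (im_part \o F) \- (im_part \o f n)).
  exact: measurable_funB.
by apply/funext => t /=; rewrite im_partD im_partN.
Qed.

Let pmass_dF n : (pmass (fun t => F t - f n t)%R <= ((4 / 2 ^+ n) `^ p)%:E)%E.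
Proof.
rewrite power_integral.unlock.
apply: (@le_trans _ _ (\int[mu]_(t in D) (((4 / 2 ^+ n) `^ p)%:E * G t)%E)%E).
  have [mr mi] := measurable_dF n.
  apply: ae_ge0_le_integral => //.
  - by move=> t Dt; rewrite lee_fin mulr_ge0 ?powR_ge0 ?weight_ge0.
  - exact: measurable_pdens.
  - by move=> t Dt; rewrite mule_ge0 ?lee_fin ?powR_ge0 ?G_ge0.
  - by apply: emeasurable_funM => //; exact: measurable_cst.
  - by apply: filterS ae_bound => t H Dt; exact: H.
rewrite ge0_integralZl_EFin ?powR_ge0//.
by rewrite -[leRHS]mule1 lee_wpmul2l// lee_fin powR_ge0.
Qed.

Lemma Lq_fast_cauchy_cvg : exists z, forall n, N (z - y n) <= 4 / 2 ^+ n.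
Proof.
have mem n : mem_Lq mu u q (fun t => F t - f n t).
  have [mr mi] := measurable_dF n; split => //.
  by apply: le_lt_trans (pmass_dF n) _; rewrite ltry.
(* The limit is the sum of [F - f 0] and [f 0], which both belong to the space. *)
have memF : mem_Lq mu u q F.
  have := mem_LqD (mem 0%N) (Lqfun_mem (f 0%N)); congr mem_Lq.
  by apply/funext => t; rewrite subrK.
exists (Lq_class (MkLqfun memF)) => n.
have -> : Lq_class (MkLqfun memF) - y n = Lq_class (MkLqfun (mem n)).
  rewrite -[y n]Lq_reprK -scaleN1r -Lq_classZ -Lq_classD; congr Lq_class.
  by apply: Lqfun_ext => t /=; rewrite mulN1r.
rewrite -(ler_powR_pos p0) ?Lq_norm_ge0 ?divr_ge0 ?exprn_ge0//.
by rewrite Lq_normX_class -lee_fin fineK ?Lqfun_pmass_fin ?pmass_dF.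
Qed.

End fast.
End Lq_complete.

(** * The metric of L^q and its completeness *)

Section Lq_metric.
Context d (X : measurableType d) (R : realType).
Variables (mu : {measure set X -> \bar R}) (D : set X) (u : weight R D).
Variables (q : {posnum R}) (k : scalar_kind).
Local Notation p := (q%:num).
Local Notation Y := (Lq mu u q k).
Local Notation N := (@Lq_norm _ _ _ mu D u q k).
Local Notation vt := (vartheta q).
Implicit Types (x y z : Y).

Lemma Lq_ballE x (e : R) : ball x e = [set y | Lq_dist x y < e].
Proof. by rewrite ballEmdist. Qed.

Lemma Lq_distC x y : Lq_dist x y = Lq_dist y x.
Proof. by rewrite /Lq_dist -opprB Lq_normN. Qed.

Lemma Lq_norm_lt_dist x y (e : R) : 0 <= e ->
  (Lq_dist x y < e `^ vt) = (N (x - y) < e).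
Proof. by move=> e0; rewrite ltr_powR_pos ?vartheta_gt0 ?Lq_norm_ge0. Qed.

(** A Cauchy filter contains balls of prescribed radii [r n]. Consecutive balls meet, so their
    centres form a sequence that converges fast; the filter converges to the limit of the
    centres. *)
Lemma Lq_complete (F : set_system Y) : ProperFilter F -> cauchy F ->
  exists z : Y, F --> z.
Proof.
move=> PF /cauchyP cF.
pose e n : R := 2 ^- n * (1 / (2 ^ n.+1)%:R) `^ p^-1.
have e0 n : 0 < e n.
  by rewrite mulr_gt0 ?powR_gt0 ?invr_gt0 ?divr_gt0 ?exprn_gt0 ?ltr0n ?expn_gt0.
(* Half of the radius that corresponds to [e n] in the metric: if balls of radii [r n] and [r n.+1]
   meet, their centres are at norm distance less than [e n]. *)
pose r n := e n `^ vt / 2.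
have r0 n : 0 < r n by rewrite divr_gt0 ?powR_gt0.
have e_decr n : e n.+1 <= e n.
  apply: ler_pM; rewrite ?powR_ge0 ?invr_ge0 ?exprn_ge0//.
    by rewrite lef_pV2 ?posrE ?exprn_gt0// ler_eXn2l ?ltr1n.
  rewrite ler_powR_pos ?invr_gt0 ?divr_ge0//.
  by rewrite !div1r lef_pV2 ?posrE ?ltr0n ?expn_gt0// ler_nat leq_exp2l.
have r_decr n : r n.+1 <= r n.
  apply: ler_wpM2r; first by rewrite invr_ge0.
  by rewrite (ler_powR_pos (vartheta_gt0 q) (ltW (e0 _)) (ltW (e0 _))).
have /choice[x Fx] n : exists x, F (ball x (r n)) by exact: cF.
have [z zx] : exists z, forall n, N (z - x n) <= 4 / 2 ^+ n.
  apply: Lq_fast_cauchy_cvg => n.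
  have -> : (2 ^- n) `^ p * (1 / (2 ^ n.+1)%:R) = e n `^ p.
    by rewrite powRM ?powR_ge0 ?invr_ge0 ?exprn_ge0// powRVK ?divr_ge0.
  rewrite ler_powR_pos ?Lq_norm_ge0 ?(ltW (e0 _))//.
  rewrite ltW// -Lq_norm_lt_dist ?(ltW (e0 _))//.
  have [y [xy x'y]] := filter_ex (filterI (Fx n) (Fx n.+1)).
  have := ball_triangle x'y (ball_sym xy).
  rewrite Lq_ballE => /lt_le_trans; apply.
  by rewrite [leRHS]splitr lerD2r r_decr.
exists z => B; rewrite -nbhs_ballE => -[/= t t0 zB].
pose s := (t / 2) `^ vt^-1.
have s0 : 0 < s by rewrite powR_gt0// divr_gt0.
have sX : s `^ vt = t / 2 by rewrite powRVK ?divr_ge0 ?vartheta_gt0 ?ltW.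
(* This [n] serves twice: [4 / 2 ^+ n] bounds the norm distance from [z] to the centre [x n], and it
   also dominates [e n], hence controls the radius [r n]. *)
have [n ns] := half_pow_small (ler0n R 4) s0.
have rn : r n <= t / 2.
  apply: (@le_trans _ _ (e n `^ vt)).
    by rewrite ler_pdivrMr// ler_peMr ?powR_ge0// ler1n.
  rewrite -sX (ler_powR_pos (vartheta_gt0 q) (ltW (e0 _)) (ltW s0)).
  apply: le_trans (ltW ns).
  rewrite /e mulrC; apply: ler_pM; rewrite ?powR_ge0 ?invr_ge0 ?exprn_ge0//.
  apply: (@le_trans _ _ 1); last by rewrite ler1n.
  suff : (1 / (2 ^ n.+1)%:R) `^ p^-1 <= 1 `^ p^-1 :> R by rewrite powR1.
  rewrite ler_powR_pos ?invr_gt0 ?divr_ge0//.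
  by rewrite ler_pdivrMr ?ltr0n ?expn_gt0// mul1r ler1n expn_gt0.
apply: filterS (Fx n) => y xy; apply: zB; rewrite [t]splitr.
apply: (@ball_triangle _ _ (x n)); last exact: le_ball xy.
by rewrite Lq_ballE /= -sX Lq_norm_lt_dist ?ltW// (le_lt_trans (zx n)).
Qed.

Lemma Lq_precompact_of_totally_bounded (A : set Y) :
  totally_bounded A -> compact (closure A).
Proof. exact/totally_bounded_compact_closure/Lq_complete. Qed.

End Lq_metric.

(** * Restriction operators on L^q *)

Section Lq_restriction.
Context d (X : measurableType d) (R : realType).
Variables (mu : {measure set X -> \bar R}) (D : set X) (u : weight R D).
Variables (q : {posnum R}) (k : scalar_kind).
Local Notation p := (q%:num).
Local Notation Y := (Lq mu u q k).
Local Notation N := (@Lq_norm _ _ _ mu D u q k).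
Local Notation pmass := (power_integral mu D u p).
Implicit Types (x y z : Y) (A B C : set X) (f g : Lqfun mu u q k).

Let mD : measurable D := measurable_weight_dom u.
Let p0 : 0 < p. Proof. by []. Qed.

Lemma Lq_norm_class_le f g :
  (forall t, D t -> modulus (f t) <= modulus (g t)) ->
  N (Lq_class f) <= N (Lq_class g).
Proof.
move=> fg; have [fr fi _] := Lqfun_mem f; have [gr gi _] := Lqfun_mem g.
rewrite -(ler_powR_pos p0 (Lq_norm_ge0 _) (Lq_norm_ge0 _)) !Lq_normX_class.
apply: fine_le; rewrite ?Lqfun_pmass_fin// power_integral.unlock.
apply: ge0_le_integral => //; [|exact: measurable_pdens..|].
  by move=> t; exact: pdens_ge0.
move=> t Dt; rewrite lee_fin ler_wpM2r ?weight_ge0//.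
by rewrite ler_powR_pos ?modulus_ge0 ?fg.
Qed.

Lemma Lq_restrictD A (mA : measurable A) x y :
  Lq_restrict mA (x + y) = Lq_restrict mA x + Lq_restrict mA y.
Proof.
have [f ->] := LqP x; have [g ->] := LqP y.
rewrite -Lq_classD !Lq_restrict_class -Lq_classD; congr Lq_class.
by apply: Lqfun_ext => t /=; rewrite /patch; case: ifP => //; rewrite addr0.
Qed.

Lemma Lq_restrictZ A (mA : measurable A) c x :
  Lq_restrict mA (c *: x) = c *: Lq_restrict mA x.
Proof.
have [f ->] := LqP x.
rewrite -Lq_classZ !Lq_restrict_class -Lq_classZ; congr Lq_class.
by apply: Lqfun_ext => t /=; rewrite /patch; case: ifP => //; rewrite mulr0.
Qed.

Lemma Lq_restrict_norm_le A (mA : measurable A) x : N (Lq_restrict mA x) <= N x.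
Proof.
rewrite -{2}[x]Lq_reprK; apply: Lq_norm_class_le => t _ /=.
by rewrite /patch; case: ifP => // _; rewrite modulus0 modulus_ge0.
Qed.

Lemma Lq_restrict_normS A B (mA : measurable A) (mB : measurable B) x :
  A `<=` B -> N (Lq_restrict mA x) <= N (Lq_restrict mB x).
Proof.
move=> AB; apply: Lq_norm_class_le => t Dt /=; rewrite /patch.
case: ifPn => [/set_mem/AB/mem_set->//|_].
by rewrite modulus0 modulus_ge0.
Qed.

(** The [p]-th power of the norm is an integral, so it is subadditive over sets for every [p > 0],
    with no triangle inequality involved. Allowing [C] to be smaller than the union lets tails be
    moved outwards. *)
Lemma Lq_restrict_normU A B C (mA : measurable A) (mB : measurable B)
    (mC : measurable C) x : C `<=` A `|` B ->
  N (Lq_restrict mC x) `^ p <=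
    N (Lq_restrict mA x) `^ p + N (Lq_restrict mB x) `^ p.
Proof.
move=> CAB; rewrite !Lq_normX_class -fineD ?Lqfun_pmass_fin//.
apply: fine_le; rewrite ?fin_numD ?Lqfun_pmass_fin// -[leRHS]mul1e.
have [r i _] := Lqfun_mem (Lqfun_restrict mC (repr x)).
apply: (pmass_le (Lqfun_mem _) (Lqfun_mem _) r i ler01) => t _ /=.
rewrite mul1r /patch; case: ifPn => [/set_mem/CAB[/mem_set->|/mem_set->]|_].
- by rewrite lerDl powR_ge0.
- by rewrite lerDr powR_ge0.
- by rewrite modulus0 powR0 ?gt_eqF// addr_ge0 ?powR_ge0.
Qed.

(** Complementarity is required only almost everywhere, because the points [c] and [d] lie neither
    in the open interval between them nor in the two outer intervals. *)
Lemma Lq_sub_restrict A B (mA : measurable A) (mB : measurable B) x :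
  {ae mu, forall t, D t -> A t <-> ~ B t} ->
  x - Lq_restrict mA x = Lq_restrict mB x.
Proof.
move=> AB; have [f ->] := LqP x.
rewrite -scaleN1r !Lq_restrict_class -Lq_classZ -Lq_classD; apply/Lq_classP.
apply: filterS AB => t AB Dt; right; rewrite /= mulN1r /patch.
have [ABt BAt] := AB Dt; have [Bt|nBt] := pselect (B t).
  by rewrite (mem_set Bt) memNset ?subr0// => /ABt.
by rewrite (memNset nBt) (mem_set (BAt nBt)) subrr.
Qed.

(** Dominated convergence: the restricted densities vanish eventually at each point of [D] and are
    dominated by the density of [x] itself. *)
Lemma Lq_restrict_small (A : nat -> set X)
    (mA : forall n, measurable (A n)) x e :
  (forall t, D t -> \forall n \near \oo, ~ A n t) -> 0 < e ->
  exists n, N (Lq_restrict (mA n) x) < e.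
Proof.
move=> A0 e0; have [f ->] := LqP x; have [fr fi ffin] := Lqfun_mem f.
have cvg0 : (pmass (Lqfun_restrict (mA n) f) @[n --> \oo] --> 0)%E.
  rewrite -[0%E](integral0 mu D) power_integral.unlock.
  apply: (@dominated_cvg _ _ _ _ _ mD _ _
    (fun t => (modulus (f t) `^ p * u t)%:E)) => //.
  - move=> n; have [r i _] := Lqfun_mem (Lqfun_restrict (mA n) f).
    exact: measurable_pdens.
  - move=> t Dt; apply: cvg_near_cst; apply: filterS (A0 t Dt) => n nAt /=.
    by rewrite /patch memNset// modulus0 powR0 ?gt_eqF// mul0r.
  - apply/integrableP; split; first exact: measurable_pdens.
    move: ffin; rewrite power_integral.unlock; congr (_ < _)%E.
    by apply: eq_integral => t; rewrite inE => Dt; rewrite gee0_abs ?pdens_ge0.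
  - move=> n t Dt; rewrite gee0_abs ?pdens_ge0// lee_fin.
    rewrite ler_wpM2r ?weight_ge0//.
    rewrite ler_powR_pos ?modulus_ge0//= /patch.
    by case: ifP => // _; rewrite modulus0 modulus_ge0.
have ep0 : 0 < e `^ p by rewrite powR_gt0.
have /fine_cvgP[_ /cvgrPdist_lt/(_ _ ep0)[n _ Hn]] := cvg0.
exists n; rewrite Lq_restrict_class -(ltr_powR_pos p0) ?Lq_norm_ge0 ?(ltW e0)//.
rewrite Lq_normX_class; have := Hn n (leqnn n).
by rewrite /= sub0r normrN ger0_norm ?fine_ge0 ?pmass_ge0.
Qed.

End Lq_restriction.

(** * Infima and filters at the ends of the interval *)

Section ereal_inf_lemmas.
Context {R : realType}.
Local Open Scope ereal_scope.

Lemma ge0_le_poweR (r : R) (x y : \bar R) : (0 < r)%R -> 0 <= x -> x <= y ->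
  x `^ r <= y `^ r.
Proof.
move=> r0 x0 xy; apply: gt0_ler_poweR;
  rewrite ?in_itv /= ?leey ?andbT ?(ltW r0)//.
exact: le_trans x0 xy.
Qed.

Lemma poweRK (r : R) (x : \bar R) : (0 < r)%R -> 0 <= x -> (x `^ r) `^ r^-1 = x.
Proof. by move=> r0 x0; rewrite -poweRrM mulfV ?gt_eqF// poweRe1. Qed.

Lemma poweRVK (r : R) (x : \bar R) : (0 < r)%R -> 0 <= x ->
  (x `^ r^-1) `^ r = x.
Proof. by move=> r0 x0; rewrite -poweRrM mulVf ?gt_eqF// poweRe1. Qed.

(** The power [r] is an increasing bijection of the nonnegative extended reals. Monotonicity gives
    one inequality, and monotonicity of the inverse power [r^-1] gives the other. *)
Lemma ereal_inf_poweR (r : R) (S : set \bar R) : (0 < r)%R ->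
  (forall x, S x -> 0 <= x) ->
  ereal_inf [set x `^ r | x in S] = ereal_inf S `^ r.
Proof.
move=> r0 S0; have infS0 : 0 <= ereal_inf S by exact/ereal_infP.
have infSr0 : 0 <= ereal_inf [set x `^ r | x in S].
  by apply/ereal_infP => _ [x _ <-]; exact: poweR_ge0.
apply/le_anti/andP; split; last first.
  apply/ereal_infP => _ [x Sx <-]; apply: ge0_le_poweR => //.
  exact: ereal_inf_lbound.
rewrite -(poweRVK r0 infSr0); apply: ge0_le_poweR => //; first exact: poweR_ge0.
apply/ereal_infP => x Sx; rewrite -(poweRK r0 (S0 x Sx)).
apply: ge0_le_poweR; rewrite ?invr_gt0//.
by apply: ereal_inf_lbound; exists x.
Qed.

(** Monotone convergence along a filter: the last hypothesis says that [g] decreases towards the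
    filter. The filter form treats finite and infinite ends of the interval at once. *)
Lemma cvg_ereal_inf_near {T : Type} (F : set_system T) {FF : Filter F}
    (S : set T) (g : T -> \bar R) :
  ereal_inf [set g x | x in S] \is a fin_num ->
  (\forall x \near F, S x) ->
  (forall x, S x -> \forall y \near F, g y <= g x) ->
  g x @[x --> F] --> ereal_inf [set g x | x in S].
Proof.
set l := ereal_inf _ => lfin FS Fle.
have lg x : S x -> l <= g x by move=> Sx; apply: ereal_inf_lbound; exists x.
have near_lt e : (0 < e)%R -> \forall x \near F, l <= g x < l + e%:E.
  move=> e0; have [_ [c Sc <-] gcl] := lb_ereal_inf_adherent e0 lfin.
  near=> x; apply/andP; split; first by apply: lg; near: x.
  by apply: le_lt_trans gcl; near: x; exact: Fle.
rewrite -(fineK lfin); apply/fine_cvgP; split.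
  apply: filterS (near_lt _ ltr01) => x /andP[lx xl].
  move: (lfin); rewrite !fin_numElt => /andP[lNy _].
  by rewrite (lt_le_trans lNy lx) (lt_le_trans xl (leey _)).
apply/cvgrPdist_lt => e e0; apply: filterS (near_lt e e0) => x.
rewrite -(fineK lfin) /=; case: (g x) => [r||].
- rewrite -EFinD lee_fin lte_fin => /andP[lr rl].
  by rewrite distrC ger0_norm ?subr_ge0// ltrBlDl.
- by rewrite -EFinD ltNge !leey.
- by rewrite leNgt ltNyr.
Unshelve. all: by end_near. Qed.

End ereal_inf_lemmas.

Section interval_ends.
Context {R : realType}.
Implicit Types (a b : \bar R).
Local Open Scope ereal_scope.

Lemma lebesgue_ae_neq (c : R) : {ae lebesgue R, forall t : lebesgueT R, t <> c}.
Proof.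
exists [set c]; split.
- by apply: sub_caratheodory; exact: measurable_set1.
- apply/negligible_outer_measure; exists [set c]; split => //.
  exact: lebesgue_measure_set1.
- by move=> t /= /contrapT.
Qed.

#[local] Instance left_end_proper a : ProperFilter (left_end a).
Proof. by case: a => [r||] /=; exact: _. Qed.

#[local] Instance right_end_proper b : ProperFilter (right_end b).
Proof. by case: b => [r||] /=; exact: _. Qed.

Lemma near_left_end_gt a : a != +oo -> \forall c \near left_end a, a < c%:E.
Proof.
case: a => [r||]//= _; first exact: nbhs_right_gt.
by apply: nearW => c; rewrite ltNyr.
Qed.

Lemma near_left_end_lt a (c : R) : a < c%:E ->
  \forall x \near left_end a, (x < c)%R.
Proof.
case: a => [r||]//=; first by rewrite lte_fin; exact: nbhs_right_lt.
by move=> _; exact/nbhs_ninfty_lt/num_real.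
Qed.

Lemma near_right_end_lt b : b != -oo -> \forall d \near right_end b, d%:E < b.
Proof.
case: b => [r||]//= _; first exact: nbhs_left_lt.
by apply: nearW => d; rewrite ltry.
Qed.

Lemma near_right_end_gt b (d : R) : d%:E < b ->
  \forall x \near right_end b, (d < x)%R.
Proof.
case: b => [r||]//=; first by rewrite lte_fin; exact: nbhs_left_gt.
by move=> _; exact/nbhs_pinfty_gt/num_real.
Qed.

(* Dominated convergence needs sequences rather than the filter [left_end a]. *)
Lemma seq_to_left_end a : a != +oo -> exists c : nat -> R,
  (forall n, a < (c n)%:E) /\
  forall t : R, a < t%:E -> \forall n \near \oo, (c n <= t)%R.
Proof.
case: a => [r||]//= _.
  exists (fun n => r + n.+1%:R^-1)%R; split=> [n|t].
    by rewrite lte_fin ltrDl invr_gt0.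
  rewrite lte_fin -subr_gt0 => rt.
  have := near_infty_natSinv_lt (PosNum rt); apply: filterS => n /= /ltW.
  by rewrite lerBrDl.
exists (fun n => - n%:R)%R; split=> [n|t _]; first by rewrite ltNyr.
by have := nbhs_infty_ger (- t)%R; apply: filterS => n; rewrite lerNl.
Qed.

(** The reflection of the real line reduces this to the left end. *)
Lemma seq_to_right_end b : b != -oo -> exists d : nat -> R,
  (forall n, (d n)%:E < b) /\
  forall t : R, t%:E < b -> \forall n \near \oo, (t <= d n)%R.
Proof.
move=> b0; have [|c [ac ct]] := @seq_to_left_end (- b).
  by rewrite eqe_oppLR.
exists (fun n => - c n)%R; split=> [n|t tb].
  by rewrite EFinN lteNl.
have := ct (- t)%R; rewrite EFinN lteN2 => /(_ tb).
by apply: filterS => n; rewrite lerNr.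
Qed.

(** Points chosen separately near the two ends need not be in order; moving them outwards puts them
    in order, and tails only shrink. *)
Lemma ivl_ends_lt a b (c0 d0 : R) : a < b -> a < c0%:E -> d0%:E < b ->
  exists c d : R, [/\ a < c%:E, (c < d)%R, d%:E < b, (c <= c0)%R & (d0 <= d)%R].
Proof.
move=> ab ac0 d0b.
have aNy : a != +oo by apply: contraTneq ab => ->; rewrite ltNge leey.
have bNy : b != -oo by apply: contraTneq ab => ->; rewrite ltNge leNye.
(* The point [c] must also stay below [b], to leave room for [d] between [c] and [b]. *)
have near_b : \forall c \near left_end a, c%:E < b.
  case: b ab {d0b bNy} => [r /near_left_end_lt||]//.
    by move=> _; apply: nearW => c; rewrite ltry.
  by rewrite ltNge leNye.
have [c [[ac cc0] cb]] := filter_ex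
  (filterI (filterI (near_left_end_gt aNy) (near_left_end_lt ac0)) near_b).
have [d [[db d0d] cd]] := filter_ex (filterI
  (filterI (near_right_end_lt bNy) (near_right_end_gt d0b))
  (near_right_end_gt cb)).
by exists c, d; split => //; exact: ltW.
Qed.

End interval_ends.

(** * Bilinear maps into L^q *)

Section bilinear_map_theory.
Variables (R : realType) (a b : \bar R) (u : weight R (ivl a b)).
Variables (q : {posnum R}) (k : scalar_kind).
Variables E1 E2 : normedModType (scalar_field R k).
Local Notation p := (q%:num).
Local Notation Y := (Lq (lebesgue R) u q k).
Local Notation N := (@Lq_norm _ _ _ (lebesgue R) (ivl a b) u q k).
Local Notation vt := (vartheta q).
Local Notation out c d :=
  (measurableU _ _ (measurable_ivl a c%:E) (measurable_ivl d%:E b)).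
Implicit Types (f g : E1 -> E2 -> Y) (T K : {bilinear E1 -> E2 -> Y}).
Local Open Scope ereal_scope.

Let p0 : (0 < p)%R. Proof. by []. Qed.
Let vt0 : (0 < vt)%R. Proof. exact: vartheta_gt0. Qed.

Lemma op_norm_leP f (M : \bar R) : op_norm f <= M <->
  forall x, unit_balls x -> (N (f x.1 x.2))%:E <= M.
Proof.
split=> [fM x Dx|fM].
  apply: le_trans fM; apply: ereal_sup_ubound.
  by exists (f x.1 x.2) => //; exists x.
by apply: ge_ereal_sup => _ [_ [x Dx <-] <-]; exact: fM.
Qed.

Lemma op_norm_ge f x : unit_balls x -> (N (f x.1 x.2))%:E <= op_norm f.
Proof. by move: x; exact/op_norm_leP. Qed.

Lemma op_norm_ge0 f : 0 <= op_norm f.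
Proof.
have D0 : unit_balls (0%R : E1, 0%R : E2) by split; rewrite normr0 ler01.
by apply: le_trans (op_norm_ge f D0); rewrite lee_fin Lq_norm_ge0.
Qed.

Lemma op_norm_le f g : (forall x y, N (f x y) <= N (g x y))%R ->
  op_norm f <= op_norm g.
Proof.
move=> fg; apply/op_norm_leP => x Dx.
by apply: le_trans (op_norm_ge g Dx); rewrite lee_fin.
Qed.

(** This makes the truncation of [T] a bilinear map, hence an admissible [K] in [ess_norm]. *)
Lemma restrict_map_bilinear S (mS : measurable S) T :
  bilinear_for *:%R *:%R (restrict_map mS T).
Proof.
split=> z c x y; rewrite /restrict_map.
  by rewrite linearPl Lq_restrictD Lq_restrictZ.
by rewrite linearPr Lq_restrictD Lq_restrictZ.
Qed.

HB.instance Definition _ S (mS : measurable S) T :=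
  bilinear_isBilinear.Build _ _ _ _ _ _ (restrict_map mS T)
    (restrict_map_bilinear mS T).

Lemma sub_truncation (c d : R) (x : Y) : (c < d)%R ->
  (x - Lq_restrict (measurable_ivl c%:E d%:E) x)%R = Lq_restrict (out c d) x.
Proof.
move=> cd; apply: Lq_sub_restrict.
apply: filterS2 (lebesgue_ae_neq c) (lebesgue_ae_neq d) => t tc td.
rewrite /ivl /= !lte_fin => /andP[at_ tb]; rewrite at_ tb andbT /=; split.
  move=> /andP[ct td'] [|]; first by rewrite ltNge (ltW ct).
  by rewrite ltNge (ltW td').
move=> /not_orP[/negP ct /negP dt]; move: ct dt; rewrite -!leNgt !le_eqVlt.
by move=> /predU1P[/esym//|->] /predU1P[//|->].
Qed.

Lemma ess_norm_le_tau T :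
  (forall c d : R, a < c%:E -> (c < d)%R -> d%:E < b ->
    compact_map (truncation c d T)) -> ess_norm T <= tau_T T.
Proof.
move=> cT; apply/ereal_infP => _ [c [d [ac cd db ->]]].
apply: (@le_trans _ _ (op_norm (fun x y => T x y - truncation c d T x y)%R)).
  apply: ereal_inf_lbound.
  exists (restrict_map (measurable_ivl c%:E d%:E) T) => //.
  exact: cT.
apply: op_norm_le => x y; rewrite /truncation /restrict_map sub_truncation //.
Qed.

Lemma chi_Y_le_ess_norm T : chi_Y (ball_image T) <= ess_norm T.
Proof.
apply/ereal_infP => _ [K cK <-].
have := op_norm_ge0 (fun x y => T x y - K x y)%R.
case nTK : (op_norm _) => [r||]//; last by move=> _; rewrite leey.
rewrite lee_fin => r0; apply/lee_addgt0Pr => e e0.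
have re0 : (0 < r + e)%R by rewrite ltr_wpDl.
have tb : totally_bounded (closure (ball_image K)).
  exact: compact_totally_bounded.
(* The triangle inequality holds for the [vt]-th power of the norm. This difference is therefore the
   radius, in the metric, that can be added to [r]^ vt[while staying within](r + e) [^ vt]. *)
have d0 : (0 < (r + e) `^ vt - r `^ vt)%R.
  by rewrite subr_gt0 ltr_powR_pos ?(ltW re0)// ltrDl.
have [s sK] := tb _ d0.
apply: ereal_inf_lbound; exists (r + e)%R => //; split=> //; exists s.
move=> _ [x Dx <-].
have [y ys] := sK (K x.1 x.2) (subset_closure (imageP _ Dx)).
rewrite Lq_ballE /= Lq_distC => Ky; exists y => //=.
rewrite -(ltr_powR_pos vt0) ?Lq_norm_ge0 ?(ltW re0)//.
rewrite -(subrKA (K x.1 x.2)) (le_lt_trans (Lq_normD_vartheta _ _))//.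
rewrite -(subrKC (r `^ vt) ((r + e) `^ vt)) ler_ltD//.
rewrite ler_powR_pos ?Lq_norm_ge0// -lee_fin -nTK.
exact: (op_norm_ge (fun x y => T x y - K x y)%R Dx).
Qed.

Lemma left_tail_small (s : seq Y) (e : R) : a < b -> (0 < e)%R ->
  exists c : R, a < c%:E /\
    forall y, y \in s -> (N (Lq_restrict (measurable_ivl a c%:E) y) < e)%R.
Proof.
move=> ab e0.
have aNy : a != +oo by apply: contraTneq ab => ->; rewrite ltNge leey.
have [c_ [ac ct]] := seq_to_left_end aNy.
elim: s => [|y s [c [ac' cs]]]; first by exists (c_ 0%N).
have [|n yn] := @Lq_restrict_small _ _ _ (lebesgue R) _ u q k
    (fun n => ivl a (c_ n)%:E) (fun n => measurable_ivl a (c_ n)%:E) y e _ e0.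
  move=> t /andP[/ct + _]; apply: filterS => n /=.
  by rewrite /ivl /= lte_fin leNgt => /negP + /andP[].
exists (Order.min c (c_ n)); split.
  by case: (leP c (c_ n)) => _.
move=> z; rewrite inE => /predU1P[->|/cs zc].
  apply: le_lt_trans yn; apply: Lq_restrict_normS => t /=.
  rewrite /ivl /= => /andP[-> /lt_le_trans]; apply.
  by rewrite lee_fin ge_min lexx orbT.
apply: le_lt_trans zc; apply: Lq_restrict_normS => t /=.
rewrite /ivl /= => /andP[-> /lt_le_trans]; apply.
by rewrite lee_fin ge_min lexx.
Qed.

Lemma right_tail_small (s : seq Y) (e : R) : a < b -> (0 < e)%R ->
  exists d : R, d%:E < b /\
    forall y, y \in s -> (N (Lq_restrict (measurable_ivl d%:E b) y) < e)%R.
Proof.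
move=> ab e0.
have bNy : b != -oo by apply: contraTneq ab => ->; rewrite ltNge leNye.
have [d_ [db dt]] := seq_to_right_end bNy.
elim: s => [|y s [d [db' ds]]]; first by exists (d_ 0%N).
have [|n yn] := @Lq_restrict_small _ _ _ (lebesgue R) _ u q k
    (fun n => ivl (d_ n)%:E b) (fun n => measurable_ivl (d_ n)%:E b) y e _ e0.
  move=> t /andP[_ /dt +]; apply: filterS => n /=.
  by rewrite /ivl /= lte_fin leNgt => /negP + /andP[].
exists (Order.max d (d_ n)); split.
  by case: (leP d (d_ n)) => _.
move=> z; rewrite inE => /predU1P[->|/ds zd].
  apply: le_lt_trans yn; apply: Lq_restrict_normS => t /=.
  rewrite /ivl /= => /andP[+ ->]; rewrite andbT; apply: le_lt_trans.
  by rewrite lee_fin le_max lexx orbT.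
apply: le_lt_trans zd; apply: Lq_restrict_normS => t /=.
rewrite /ivl /= => /andP[+ ->]; rewrite andbT; apply: le_lt_trans.
by rewrite lee_fin le_max lexx.
Qed.

Lemma tails_small (s : seq Y) (e : R) : a < b -> (0 < e)%R ->
  exists c d : R, [/\ a < c%:E, (c < d)%R, d%:E < b &
    forall y, y \in s -> (N (Lq_restrict (out c d) y) <= e)%R].
Proof.
move=> ab e0; pose h := ((e `^ p / 2) `^ p^-1)%R.
have h0 : (0 < h)%R by rewrite powR_gt0// divr_gt0// powR_gt0.
have [c0 [ac0 hc0]] := left_tail_small s ab h0.
have [d0 [d0b hd0]] := right_tail_small s ab h0.
have [c [d [ac cd db cc0 d0d]]] := ivl_ends_lt ab ac0 d0b.
exists c, d; split => // y ys.
rewrite -(ler_powR_pos p0) ?Lq_norm_ge0 ?(ltW e0)//.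
apply: le_trans (Lq_restrict_normU (measurable_ivl a c0%:E)
  (measurable_ivl d0%:E b) _ _ _) _.
  move=> t [] /andP[h1 h2]; [left|right]; rewrite /ivl /=.
    by rewrite h1 (lt_le_trans h2)// lee_fin.
  by rewrite h2 andbT (le_lt_trans _ h1)// lee_fin.
have -> : (e `^ p = h `^ p + h `^ p)%R.
  by rewrite powRVK ?divr_ge0 ?powR_ge0// -splitr.
by apply: lerD; rewrite ler_powR_pos ?Lq_norm_ge0 ?(ltW h0)// ltW ?hc0 ?hd0.
Qed.

Lemma tau_le_chi_Y T : a < b -> tau_T T <= chi_Y (ball_image T).
Proof.
move=> ab; apply/ereal_infP => _ [e [e0 [s Ts]] <-].
apply/lee_addgt0Pr => r r0; have er0 : (0 < e + r)%R by rewrite addr_gt0.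
pose h := (((e + r) `^ vt - e `^ vt) `^ vt^-1)%R.
have diff0 : (0 < (e + r) `^ vt - e `^ vt)%R.
  by rewrite subr_gt0 ltr_powR_pos ?(ltW e0) ?(ltW er0)// ltrDl.
have [c [d [ac cd db sh]]] := tails_small s ab (powR_gt0 vt^-1 diff0).
apply: (@le_trans _ _ (gamma_T T c d)).
  by apply: ereal_inf_lbound; exists c, d.
apply/op_norm_leP => x Dx; rewrite -EFinD lee_fin.
have [y /= ys Ty] := Ts _ (imageP _ Dx).
rewrite -(ler_powR_pos vt0) ?Lq_norm_ge0 ?(ltW er0)//.
rewrite /restrict_map -(subrK y (T x.1 x.2)) Lq_restrictD.
apply: le_trans (Lq_normD_vartheta _ _) _.
rewrite -(subrKC (e `^ vt) ((e + r) `^ vt)); apply: lerD.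
  rewrite ler_powR_pos ?Lq_norm_ge0 ?(ltW e0)//.
  exact: le_trans (Lq_restrict_norm_le _ _) (ltW Ty).
rewrite -[leRHS](powRVK vt0 (ltW diff0)).
by rewrite (ler_powR_pos vt0 (Lq_norm_ge0 _) (powR_ge0 _ _)) sh.
Qed.

Lemma ess_vartheta_poweR f : ess_vartheta f = ess_norm f `^ vt.
Proof.
rewrite /ess_vartheta /ess_norm -ereal_inf_poweR//; last first.
  by move=> _ [K _ <-]; exact: op_norm_ge0.
by rewrite image_comp.
Qed.

Lemma chi_rho_poweR (A : set Y) : chi_rho A = chi_Y A `^ vt.
Proof.
rewrite /chi_Y -ereal_inf_poweR//; last first.
  by move=> _ [e [e0 _] <-]; rewrite lee_fin ltW.
rewrite image_comp /chi_rho; congr ereal_inf; apply/seteqP; split=> x.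
  move=> [e [e0 [s As]] <-].
  have ev0 : (0 < e `^ vt^-1)%R by rewrite powR_gt0.
  exists (e `^ vt^-1)%R => /=; last by rewrite powRVK ?(ltW e0).
  split=> //; exists s => y /As[z zs yz]; exists z => //=.
  by rewrite -Lq_norm_lt_dist ?(ltW ev0)// powRVK ?(ltW e0).
move=> [e [e0 [s As]] <-]; exists (e `^ vt)%R => //=; split.
  exact: powR_gt0.
exists s => y /As[z zs yz]; exists z => //=.
by rewrite Lq_norm_lt_dist ?(ltW e0).
Qed.

Lemma compact_map_chi_rho0 T : chi_rho (ball_image T) = 0 -> compact_map T.
Proof.
move=> chi0; apply: Lq_precompact_of_totally_bounded => e e0.
have /ereal_inf_lt[_ [r [r0 [s Ts]] <-]] : chi_rho (ball_image T) < e%:E.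
  by rewrite chi0 lte_fin.
rewrite lte_fin => re; exists s => y /Ts[z zs yz]; exists z => //.
by rewrite Lq_ballE /= Lq_distC (lt_trans yz).
Qed.

(** The map [T] is itself an admissible [K]. *)
Lemma ess_norm_compact T : compact_map T -> ess_norm T <= 0.
Proof.
move=> cT; apply: ge_ereal_inf; eexists; first by exists T.
apply/op_norm_leP => x _; by rewrite subrr Lq_norm0.
Qed.

(** * One-sided tails, their limits and the bounds on [tau_T] *)

Lemma alpha_le f (c c' : R) : (c <= c')%R -> alpha_T f c <= alpha_T f c'.
Proof.
move=> cc'; apply: op_norm_le => x y; apply: Lq_restrict_normS => t.
by move=> /andP[h1 h2]; rewrite /ivl /= h1 (lt_le_trans h2)// lee_fin.
Qed.

Lemma beta_le f (d d' : R) : (d' <= d)%R -> beta_T f d <= beta_T f d'.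
Proof.
move=> dd'; apply: op_norm_le => x y; apply: Lq_restrict_normS => t.
by move=> /andP[h1 h2]; rewrite /ivl /= h2 andbT (le_lt_trans _ h1)// lee_fin.
Qed.

Lemma alpha_le_gamma f c d : alpha_T f c <= gamma_T f c d.
Proof.
by apply: op_norm_le => x y; apply: Lq_restrict_normS; exact: subsetUl.
Qed.

Lemma beta_le_gamma f c d : beta_T f d <= gamma_T f c d.
Proof.
by apply: op_norm_le => x y; apply: Lq_restrict_normS; exact: subsetUr.
Qed.

Lemma restrict_map_bounded S (mS : measurable S) f :
  bounded_map f -> op_norm (restrict_map mS f) \is a fin_num.
Proof.
move=> bf; rewrite ge0_fin_numE ?op_norm_ge0//; apply: le_lt_trans bf.
by apply: op_norm_le => x y; exact: Lq_restrict_norm_le.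
Qed.

Lemma gamma_powR f (c d : R) : bounded_map f ->
  (fine (gamma_T f c d) `^ p <=
    fine (alpha_T f c) `^ p + fine (beta_T f d) `^ p)%R.
Proof.
move=> bf; set r := (X in (_ <= X)%R).
have r0 : (0 <= r)%R by rewrite addr_ge0 ?powR_ge0.
(* The right-hand side is written as a [p]-th power, so that the claim becomes a bound on an
   operator norm and can be checked at each point of the unit balls. *)
rewrite -[leRHS](powRVK p0)// ler_powR_pos ?powR_ge0 ?fine_ge0 ?op_norm_ge0//.
rewrite -lee_fin (fineK (restrict_map_bounded _ bf)); apply/op_norm_leP => x Dx.
rewrite lee_fin -(ler_powR_pos p0 (Lq_norm_ge0 _) (powR_ge0 _ _)).
rewrite (powRVK p0 r0).
apply: le_trans (Lq_restrict_normU (measurable_ivl a c%:E)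
  (measurable_ivl d%:E b) _ _ (@subset_refl _ _)) _.
apply: lerD; rewrite ler_powR_pos ?Lq_norm_ge0 ?fine_ge0 ?op_norm_ge0//.
  rewrite -lee_fin (fineK (restrict_map_bounded _ bf)).
  exact: (op_norm_ge (restrict_map _ f) Dx).
rewrite -lee_fin (fineK (restrict_map_bounded _ bf)).
exact: (op_norm_ge (restrict_map _ f) Dx).
Qed.

(** By monotonicity of the tails this infimum is the limit at the left end, as [cvg_alpha] shows;
    the bounds on [tau_T] are proved for infima first. *)
Definition alpha_inf f :=
  ereal_inf [set alpha_T f c | c in [set c : R | a < c%:E]].

Definition beta_inf f :=
  ereal_inf [set beta_T f d | d in [set d : R | d%:E < b]].

Lemma alpha_inf_ge0 f : 0 <= alpha_inf f.
Proof. by apply/ereal_infP => _ [c _ <-]; exact: op_norm_ge0. Qed.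

Lemma beta_inf_ge0 f : 0 <= beta_inf f.
Proof. by apply/ereal_infP => _ [d _ <-]; exact: op_norm_ge0. Qed.

Lemma tau_ge0 f : 0 <= tau_T f.
Proof. by apply/ereal_infP => _ [c [d [_ _ _ ->]]]; exact: op_norm_ge0. Qed.

Section bounded.
Hypothesis ab : a < b.
Variable f : E1 -> E2 -> Y.
Hypothesis bf : bounded_map f.

Let aNy : a != +oo.
Proof. by apply: contraTneq ab => ->; rewrite ltNge leey. Qed.
Let bNy : b != -oo.
Proof. by apply: contraTneq ab => ->; rewrite ltNge leNye. Qed.

Lemma alpha_inf_fin_num : alpha_inf f \is a fin_num.
Proof.
have [c ac] := @filter_ex _ _ (left_end_proper a) _ (near_left_end_gt aNy).
rewrite ge0_fin_numE ?alpha_inf_ge0//.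
apply: (@le_lt_trans _ _ (alpha_T f c)).
  by apply: ereal_inf_lbound; exists c.
by rewrite -ge0_fin_numE ?op_norm_ge0// restrict_map_bounded.
Qed.

Lemma beta_inf_fin_num : beta_inf f \is a fin_num.
Proof.
have [d db] := @filter_ex _ _ (right_end_proper b) _ (near_right_end_lt bNy).
rewrite ge0_fin_numE ?beta_inf_ge0//.
apply: (@le_lt_trans _ _ (beta_T f d)).
  by apply: ereal_inf_lbound; exists d.
by rewrite -ge0_fin_numE ?op_norm_ge0// restrict_map_bounded.
Qed.

Lemma cvg_alpha : alpha_T f c @[c --> left_end a] --> alpha_inf f.
Proof.
have FF := left_end_proper a; apply: cvg_ereal_inf_near.
- exact: alpha_inf_fin_num.
- exact: near_left_end_gt.
- by move=> c /near_left_end_lt; apply: filterS => x /ltW; exact: alpha_le.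
Qed.

Lemma cvg_beta : beta_T f d @[d --> right_end b] --> beta_inf f.
Proof.
have FF := right_end_proper b; apply: cvg_ereal_inf_near.
- exact: beta_inf_fin_num.
- exact: near_right_end_lt.
- by move=> d /near_right_end_gt; apply: filterS => x /ltW; exact: beta_le.
Qed.

Lemma max_le_tau : Order.max (alpha_inf f) (beta_inf f) <= tau_T f.
Proof.
apply/ereal_infP => _ [c [d [ac _ db ->]]]; rewrite ge_max; apply/andP; split.
  by apply: le_trans (alpha_le_gamma f c d); apply: ereal_inf_lbound; exists c.
by apply: le_trans (beta_le_gamma f c d); apply: ereal_inf_lbound; exists d.
Qed.

Lemma tau_le_powR :
  tau_T f <= (alpha_inf f `^ p + beta_inf f `^ p) `^ p^-1.
Proof.
have af := alpha_inf_fin_num; have bf' := beta_inf_fin_num.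
have a0 := alpha_inf_ge0 f; have b0 := beta_inf_ge0 f.
set A := alpha_inf f in af a0 *; set B := beta_inf f in bf' b0 *.
rewrite -(fineK af) -(fineK bf') !poweR_EFin.
have A0 : (0 <= fine A)%R by rewrite fine_ge0.
have B0 : (0 <= fine B)%R by rewrite fine_ge0.
(* The comparison is made between [p]-th powers, where the two tails add up; the error [e] is then
   shared equally between the two ends. *)
rewrite -(@poweRK _ p (tau_T f))// ?tau_ge0// -poweR_EFin.
apply: ge0_le_poweR; rewrite ?invr_gt0 ?poweR_ge0//.
apply/lee_addgt0Pr => e e0; have e20 : (0 < e / 2)%R by rewrite divr_gt0.
have approx (r : R) : (0 <= r)%R -> (r < (r `^ p + e / 2) `^ p^-1)%R.
  move=> r0; rewrite -(ltr_powR_pos p0) ?powR_ge0// powRVK ?ltrDl//.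
  by rewrite addr_ge0 ?powR_ge0 ?ltW.
have /ereal_inf_lt[_ [c0 ac0 <-] Ac0] :
    alpha_inf f < ((fine A `^ p + e / 2) `^ p^-1)%:E.
  by rewrite -/A -(fineK af) lte_fin approx.
have /ereal_inf_lt[_ [d0 d0b <-] Bd0] :
    beta_inf f < ((fine B `^ p + e / 2) `^ p^-1)%:E.
  by rewrite -/B -(fineK bf') lte_fin approx.
have [c [d [ac cd db cc0 d0d]]] := ivl_ends_lt ab ac0 d0b.
have gfin : gamma_T f c d \is a fin_num by exact: restrict_map_bounded.
apply: (@le_trans _ _ (gamma_T f c d `^ p)).
  apply: ge0_le_poweR; rewrite ?tau_ge0//.
  by apply: ereal_inf_lbound; exists c, d.
rewrite -(fineK gfin) poweR_EFin -EFinD lee_fin.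
apply: le_trans (gamma_powR c d bf) _.
rewrite [e]splitr addrACA; apply: lerD.
  rewrite -[leRHS](powRVK p0) ?addr_ge0 ?powR_ge0 ?(ltW e20)//.
  rewrite ler_powR_pos ?fine_ge0 ?op_norm_ge0 ?powR_ge0//.
  rewrite -lee_fin (fineK (restrict_map_bounded _ bf)).
  exact: le_trans (alpha_le f cc0) (ltW Ac0).
rewrite -[leRHS](powRVK p0) ?addr_ge0 ?powR_ge0 ?(ltW e20)//.
rewrite ler_powR_pos ?fine_ge0 ?op_norm_ge0 ?powR_ge0//.
rewrite -lee_fin (fineK (restrict_map_bounded _ bf)).
exact: le_trans (beta_le f d0d) (ltW Bd0).
Qed.

Lemma tau_eq0 : tau_T f = 0 <-> alpha_inf f = 0 /\ beta_inf f = 0.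
Proof.
split=> [t0|[a0 b0]].
  have := max_le_tau; rewrite t0 ge_max => /andP[a0 b0].
  by split; apply/le_anti; rewrite ?a0 ?b0 ?alpha_inf_ge0 ?beta_inf_ge0.
apply/le_anti; rewrite tau_ge0 andbT; apply: le_trans tau_le_powR _.
by rewrite a0 b0 poweR0r ?gt_eqF// adde0 poweR0r// invr_eq0 gt_eqF.
Qed.

End bounded.
End bilinear_map_theory.

Local Open Scope ereal_scope.

Theorem theorem5p1 (R : realType) (a b : \bar R) (hab : a < b)
    (u : weight R (ivl a b)) (hu : loc_integrable a b u)
    (q : {posnum R}) (k : scalar_kind)
    (E1 E2 : normedModType (scalar_field R k))
    (T : {bilinear E1 -> E2 -> Lq (lebesgue R) u q k})
    (hT : bounded_map T)
    (hTcd : forall c d : R, a < c%:E -> (c < d)%R -> d%:E < b ->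
      compact_map (truncation c d T)) :
  [/\ ess_norm T = chi_Y (ball_image T) /\ chi_Y (ball_image T) = tau_T T,
      ess_vartheta T = chi_rho (ball_image T) /\
        chi_rho (ball_image T) = tau_T T `^ vartheta q,
      (compact_map T <-> tau_T T = 0) /\
        (tau_T T = 0 <-> (alpha_T T c @[c --> left_end a] --> 0 /\
                        beta_T T d @[d --> right_end b] --> 0)),
      cvg (alpha_T T c @[c --> left_end a]) /\
        cvg (beta_T T d @[d --> right_end b])
    & let alpha_ := lim (alpha_T T c @[c --> left_end a]) in
      let beta_ := lim (beta_T T d @[d --> right_end b]) in
      Order.max alpha_ beta_ <= tau_T T <=
        (alpha_ `^ q%:num + beta_ `^ q%:num) `^ (q%:num)^-1].
Proof.
have chi_tau : chi_Y (ball_image T) = tau_T T.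
  apply/le_anti; rewrite tau_le_chi_Y// andbT.
  exact: le_trans (chi_Y_le_ess_norm T) (ess_norm_le_tau hTcd).
have ess_chi : ess_norm T = chi_Y (ball_image T).
  by apply/le_anti; rewrite chi_Y_le_ess_norm chi_tau ess_norm_le_tau.
have limE (F : set_system R) (FF : ProperFilter F) (g : R -> \bar R) l :
    g x @[x --> F] --> l -> lim (g x @[x --> F]) = l by move=> /cvg_lim; apply.
have cva := cvg_alpha hab hT; have cvb := cvg_beta hab hT.
have lfa := left_end_proper a; have rfb := right_end_proper b.
split.
- by split.
- by rewrite ess_vartheta_poweR chi_rho_poweR ess_chi chi_tau.
- split; split.
  + move=> /ess_norm_compact; rewrite ess_chi chi_tau => t0.
    by apply/le_anti; rewrite t0 tau_ge0.
  + move=> t0; apply: compact_map_chi_rho0.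
    by rewrite chi_rho_poweR chi_tau t0 poweR0r// gt_eqF// vartheta_gt0.
  + move=> /(tau_eq0 hab hT)[a0 b0].
    by move: cva cvb; rewrite a0 b0.
  (* Uniqueness of limits identifies the assumed limits 0 with the infima. *)
  + move=> [a0 b0]; apply/(tau_eq0 hab hT); split.
      by rewrite -(limE _ _ _ _ cva) (limE _ _ _ _ a0).
    by rewrite -(limE _ _ _ _ cvb) (limE _ _ _ _ b0).
- by split; apply/cvg_ex; eexists; [exact: cva|exact: cvb].
- by rewrite /= (limE _ _ _ _ cva) (limE _ _ _ _ cvb) max_le_tau ?tau_le_powR.
Qed.
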